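(* Let $I\subseteq[d]$ be nonempty and write $k=|I|$. (i) The coefficient $1/(2k)$ in the bound $|\mathbb E_f[\varphi]|\le\frac1{2k}\Lambda_{\mathrm{sl}}^I(\varphi)\,\mathrm{TV}_I(f;S)$ (valid for probability densities $f\in BV(S)$ and $\varphi\in W^{1,\infty}(S)$ centered on $I$) is optimal: for every $C<\frac1{2k}$ there exist a probability density $f\in C^\infty(\overline S)$ and a $\varphi\in W^{1,\infty}(S)$ centered on $I$ with $|\mathbb E_f[\varphi]|>C\,\Lambda_{\mathrm{sl}}^I(\varphi)\,\mathrm{TV}_I(f;S)$. The same conclusion holds with $\mathrm{TV}_I(f;S)$ replaced by $\mathrm{TV}_\infty(f;S)$. (ii) The coefficient $2^{-k}$ in the bound $\left|\int_S\varphi f\,d\omega\right|\le2^{-k}\Lambda_{\mathrm{mix}}^I(\varphi)\int_S|\partial_If|\,d\omega$ (valid for $f\in C^k(\overline S)$ and $\varphi\in L^\infty(S)$ centered on $I$) is optimal, even over smooth probability densities and centered residuals in $W^{1,\infty}(S)$: for every $C<2^{-k}$ there exist a probability density $f\in C^\infty(\overline S)$ and a $\varphi\in W^{1,\infty}(S)$ centered on $I$ with $|\mathbb E_f[\varphi]|>C\,\Lambda_{\mathrm{mix}}^I(\varphi)\int_S|\partial_If|\,d\omega$. (iii) For $I=[d]$, the coefficient $2^{-d}$ in the smooth bound $\left|\int_S\varphi f\,d\omega\right|\le2^{-d}\|\varphi\|_{L^1(S)}V(f;S)$ (valid for $f\in C^d(\overline S)$ and $\varphi\in L^\infty(S)$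 centered on $[d]$) is optimal, i.e. it cannot be replaced by any smaller constant. (iv) The coefficient one multiplying $\|\mathcal R_I\varphi\|_{L^\infty(S)}$ in the defect-adjusted bounds $$|\mathbb E_f[\varphi]|\le\frac1{2k}\Lambda_{\mathrm{sl}}^I(\mathcal P_I\varphi)\,\mathrm{TV}_I(f;S)+\|\mathcal R_I\varphi\|_{L^\infty(S)},\qquad |\mathbb E_f[\varphi]|\le2^{-k}\Lambda_{\mathrm{mix}}^I(\mathcal P_I\varphi)\int_S|\partial_If|\,d\omega+\|\mathcal R_I\varphi\|_{L^\infty(S)}$$ (valid for $\varphi\in L^\infty(S)$ and probability densities $f\in BV(S)$, respectively $f\in C^k(\overline S)$) is optimal, i.e. in neither bound can it be replaced by a constant smaller than one.
   Context: Let $d\ge 1$, $[d]=\{1,\dots,d\}$, and let $S=\prod_{i=1}^d[a_i,b_i]\subset\mathbb R^d$ be a fixed box with $a_i<b_i$. For $I\subseteq[d]$ write $\omega_I=(\omega_i)_{i\in I}$, $\omega_{-I}=(\omega_j)_{j\notin I}$, $S_I=\prod_{i\in I}[a_i,b_i]$, $S_{-I}=\prod_{j\notin I}[a_j,b_j]$ (a singleton if $I=[d]$), and $-i$ for $-\{i\}$. A probability density on $S$ is a nonnegative integrable function with integral $1$; $\mathbb E_f[\varphi]=\int_S\varphi f\,d\omega$. $C^k(\overline S)$: functions $C^k$ up to the boundary of $S$; $C^\infty(\overline S)$: functions extending smoothly to an open neighborhood of $S$. Projectors: $(\Pi_i\varphi)(\omega)=\frac1{b_i-a_i}\int_{a_i}^{b_i}\varphi(\omega_{-i},t)\,dt$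 ($t$ inserted in coordinate $i$); these commute. $\mathcal P_I=\prod_{i\in I}(\mathrm{Id}-\Pi_i)$, $\mathcal R_I=\mathrm{Id}-\mathcal P_I$. $\varphi$ is centered on $I$ if $\Pi_i\varphi=0$ a.e. for all $i\in I$. Envelopes: $$\Lambda_{\mathrm{sl}}^I(\varphi)=\max_{i\in I}\operatorname*{ess\,sup}_{\omega_{-i}\in S_{-i}}\int_{a_i}^{b_i}|\varphi(\omega_{-i},t)|\,dt,\qquad \Lambda_{\mathrm{mix}}^I(\varphi)=\operatorname*{ess\,sup}_{\omega_{-I}\in S_{-I}}\int_{S_I}|\varphi(\omega_{-I},t_I)|\,dt_I.$$ Variation: $D_if$ is the $i$th distributional derivative measure on the interior of $S$, $|D_if|(S)$ its total variation mass there, $\mathrm{TV}_I(f;S)=\sum_{i\in I}|D_if|(S)$, $\mathrm{TV}_\infty(f;S)=\sum_{i=1}^d|D_if|(S)$. For $I=\{i_1<\cdots<i_k\}$, $\partial_If=\partial_{i_1}\cdots\partial_{i_k}f$. Vitali variation: $V(f;S)=\sup_{\mathcal Q}\sum_{S_j\in\mathcal Q}|\sigma(f,S_j)|$ over finite families $\mathcal Q$ of axis-parallel closed boxes $S_j=\prod_\ell[a^j_\ell,b^j_\ell]$ with pairwise disjoint interiors and union $S$, where $\sigma(f,S_j)=\sum_{\nu\in\{0,1\}^d}(-1)^{\nu_1+\cdots+\nu_d}f(b^j+\nu\odot(a^j-b^j))$. For $f\in C^d(\overline S)$ one has $V(f;S)=\int_S|\partial_1\cdots\partial_df|\,d\omega$.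 *)

(* Defs.v *)
From HB Require Import structures.
From mathcomp Require Import all_boot all_order all_algebra.
From mathcomp Require Import all_classical all_reals all_analysis.
From mathcomp Require Import ess_sup_inf.

Set Implicit Arguments.
Unset Strict Implicit.
Unset Printing Implicit Defensive.

Import Order.TTheory GRing.Theory Num.Theory.
Import numFieldNormedType.Exports.

Local Open Scope classical_set_scope.
Local Open Scope ring_scope.

(* R^n is 'rV[R]_n, with the sigma-algebra generated by the coordinates
   (the Borel one). *)
Section measurable_rV.
Context (R : realType) (n : nat).

Definition coord_rV (i : 'I_n) (x : 'rV[R]_n) : R := x ord0 i.

Let rV_set0 : g_sigma_preimage coord_rV set0.
Proof. exact: sigma_algebra0. Qed.

Let rV_setC A : g_sigma_preimage coord_rV A -> g_sigma_preimage coord_rV (~` A).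
Proof. exact: sigma_algebraC. Qed.

Let rV_bigcup (F : (set 'rV[R]_n)^nat) :
  (forall i, g_sigma_preimage coord_rV (F i)) ->
  g_sigma_preimage coord_rV (\bigcup_i (F i)).
Proof. exact: sigma_algebra_bigcup. Qed.

HB.instance Definition _ :=
  @isMeasurable.Build (measure_tuple_display default_measure_display)
    'rV[R]_n (g_sigma_preimage coord_rV) rV_set0 rV_setC rV_bigcup.

End measurable_rV.

Lemma measurable_coord_rV (R : realType) (n : nat) (i : 'I_n) :
  measurable_fun [set: 'rV[R]_n] (fun x : 'rV[R]_n => x ord0 i).
Proof.
move=> _ Y mY; rewrite setTI; apply: sub_sigma_algebra => /=.
rewrite -bigcup_seq/=; exists i => /=; first by rewrite mem_index_enum.
by exists Y => //; rewrite setTI.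
Qed.

Lemma measurable_fun_rVP d (T : measurableType d) (R : realType) (n : nat)
    (f : T -> 'rV[R]_n) :
  (forall i, measurable_fun [set: T] (fun x => f x ord0 i)) ->
  measurable_fun [set: T] f.
Proof.
move=> mf.
suff sub : (g_sigma_preimage (@coord_rV R n)) `<=`
    [set A | measurable (f @^-1` A)].
  by move=> _ A mA; rewrite setTI; exact: sub.
apply: smallest_sub.
- split=> [|A /= mA|F /= mF].
  + by rewrite /= preimage_set0.
  + by rewrite setTD preimage_setC; exact: measurableC.
  + by rewrite preimage_bigcup; exact: bigcupT_measurable.
- rewrite -bigcup_seq => A [/= i _ [B mB <-]]; rewrite setTI.
  by have := mf i measurableT B mB; rewrite setTI.
Qed.

Section lebesgue_step.
Context (R : realType) (n : nat).
Variable mu : {sigma_finite_measure set 'rV[R]_n -> \bar R}.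

Definition rV_cons (p : measurableTypeR R * 'rV[R]_n) : 'rV[R]_n.+1 :=
  \row_j oapp (p.2 ord0) (p.1 : R) (unlift ord0 j).

Definition rV_uncons (x : 'rV[R]_n.+1) : measurableTypeR R * 'rV[R]_n :=
  (x ord0 ord0, \row_j x ord0 (lift ord0 j)).

Lemma rV_consK : cancel rV_cons rV_uncons.
Proof.
move=> [t y]; rewrite /rV_uncons; congr pair.
- by rewrite mxE unlift_none.
- by apply/rowP => j; rewrite !mxE liftK.
Qed.

Lemma rV_unconsK : cancel rV_uncons rV_cons.
Proof.
move=> x; apply/rowP => j; rewrite mxE.
by case: unliftP => [k|] -> //=; rewrite mxE.
Qed.

Lemma measurable_rV_cons : measurable_fun setT rV_cons.
Proof.
apply: measurable_fun_rVP => i; under eq_fun do rewrite mxE.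
case: (unlift ord0 i) => [k|] /=; last exact: measurable_fst.
by apply: (measurableT_comp (measurable_coord_rV k)); exact: measurable_snd.
Qed.

Lemma measurable_rV_uncons : measurable_fun setT rV_uncons.
Proof.
apply/measurable_fun_pair; first exact: measurable_coord_rV.
apply: measurable_fun_rVP => i.
under eq_fun do rewrite mxE.
exact: measurable_coord_rV.
Qed.

Definition lebesgue_step : set 'rV[R]_n.+1 -> \bar R :=
  pushforward (lebesgue_measure \x mu)%E rV_cons.

Let push : {measure set 'rV[R]_n.+1 -> \bar R} :=
  measure_function_pushforward__canonical__measure_function_Measure
    (lebesgue_measure \x mu)%E measurable_rV_cons.

Let step0 : lebesgue_step set0 = 0%E.
Proof. by rewrite /lebesgue_step /pushforward preimage_set0 measure0. Qed.

Let step_ge0 A : (0 <= lebesgue_step A)%E.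
Proof. exact: (@measure_ge0 _ _ _ push). Qed.

Let step_sigma_additive : semi_sigma_additive lebesgue_step.
Proof.
exact: (@measure_semi_sigma_additive _ _ _ push).
Qed.

HB.instance Definition _ := isMeasure.Build _ _ _ lebesgue_step
  step0 step_ge0 step_sigma_additive.

Let step_sigma_finite : sigma_finite setT lebesgue_step.
Proof.
pose leb1 : {sigma_finite_measure set (measurableTypeR R) -> \bar R} :=
  lebesgue_measure.
have /sigma_finiteP[F [TF ndF Foo]] := sigma_finiteT leb1.
have /sigma_finiteP[G [TG ndG Goo]] := sigma_finiteT mu.
exists (fun k => rV_uncons @^-1` (F k `*` G k)).
- rewrite -preimage_bigcup (_ : \bigcup_k _ = setT) ?preimage_setT//.
  rewrite -subTset => -[x y] _.
  have [k _ Fkx] : (\bigcup_k F k) x by rewrite -TF.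
  have [l _ Gly] : (\bigcup_k G k) y by rewrite -TG.
  exists (maxn k l) => //; split.
  + by move: x Fkx; exact/subsetPset/ndF/leq_maxl.
  + by move: y Gly; exact/subsetPset/ndG/leq_maxr.
- move=> k; have [mF Fk] := Foo k; have [mG Gk] := Goo k.
  have mFG : measurable (F k `*` G k) by exact: measurableX.
  split.
    by rewrite -[X in measurable X]setTI; exact: measurable_rV_uncons.
  rewrite /lebesgue_step /pushforward -comp_preimage.
  rewrite (_ : _ \o _ = id) ?preimage_id; last exact/funext/rV_consK.
  by rewrite [ltLHS](product_measure1E leb1 mu mF mG) lte_mul_pinfty// ge0_fin_numE.
Qed.

HB.instance Definition _ := Measure_isSigmaFinite.Build _ _ _ lebesgue_step
  step_sigma_finite.

End lebesgue_step.

Fixpoint lebesgue_rV (R : realType) (n : nat) :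
    {sigma_finite_measure set 'rV[R]_n -> \bar R} :=
  match n with
  | 0%N => @dirac _ 'rV[R]_0 0 R
  | m.+1 => lebesgue_step (lebesgue_rV R m)
  end.

Section box.
Context (R : realType) (n : nat).
Implicit Types lo hi : 'rV[R]_n.

Definition box lo hi : set 'rV[R]_n :=
  [set x | forall i, lo ord0 i <= x ord0 i <= hi ord0 i].

Lemma measurable_box lo hi : measurable (box lo hi).
Proof.
rewrite (_ : box lo hi = \bigcap_(i in [set: 'I_n])
    ((fun x : 'rV[R]_n => x ord0 i) @^-1` `[lo ord0 i, hi ord0 i])).
  apply: fin_bigcap_measurable => // i _; rewrite -[X in measurable X]setTI.
  by apply: measurable_coord_rV => //; exact: measurable_itv.
by apply/seteqP; split => x bx i; [move=> _ /=|move: (bx i Logic.I) => /=];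
  rewrite in_itv//=; exact: bx.
Qed.

Definition lebesgue_box lo hi := mrestr (lebesgue_rV R n) (measurable_box lo hi).

End box.

Lemma lebesgue_rV_box (R : realType) (n : nat) (lo hi : 'rV[R]_n) :
  (forall i, lo ord0 i <= hi ord0 i) ->
  lebesgue_rV R n (box lo hi) = (\prod_(i < n) (hi ord0 i - lo ord0 i))%:E.
Proof.
elim: n lo hi => [|n ih] lo hi lohi.
  rewrite big_ord0 /= diracE mem_set//= => -[].
  by [].
pose leb1 : {sigma_finite_measure set (measurableTypeR R) -> \bar R} :=
  lebesgue_measure.
pose tl (x : 'rV[R]_n.+1) : 'rV[R]_n := \row_j x ord0 (lift ord0 j).
rewrite /= /lebesgue_step /pushforward.
rewrite (_ : _ @^-1` _ =
    `[lo ord0 ord0, hi ord0 ord0] `*` box (tl lo) (tl hi)); last first.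
  apply/seteqP; split => -[t y] /=.
  - move=> bx; split; first by have := bx ord0; rewrite mxE unlift_none in_itv.
    by move=> j; have := bx (lift ord0 j); rewrite !mxE liftK.
  - move=> [tb yb] i; rewrite mxE; case: unliftP => [j|] ->/=.
    + by have := yb j; rewrite !mxE.
    + by move: tb; rewrite in_itv.
rewrite [LHS](product_measure1E leb1 (lebesgue_rV R n))//; last first.
  exact: measurable_box.
rewrite ih => [|i]; last by rewrite !mxE.
rewrite /leb1 /= lebesgue_measure_itv/= lte_fin big_ord_recl.
under eq_bigr do rewrite !mxE.
have := lohi ord0; rewrite le_eqVlt => /predU1P[->|lt0].
- by rewrite ltxx subrr mul0r mul0e.
- by rewrite lt0 -EFinB -EFinM.
Qed.

Arguments lebesgue_rV {R} n.

Section derivatives.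
Context (R : realType) (d : nat).
Implicit Types (f g : 'rV[R]_d -> R) (U : set 'rV[R]_d) (s : seq 'I_d).

Definition partial (i : 'I_d) f : 'rV[R]_d -> R :=
  fun x => 'D_(delta_mx ord0 i) f x.

Definition partials s f : 'rV[R]_d -> R := foldr partial f s.

Definition Ck_on U (k : nat) f :=
  forall s, (size s <= k)%N -> forall x, U x ->
    {for x, continuous (partials s f)} /\
    ((size s < k)%N -> forall i, derivable (partials s f) x (delta_mx ord0 i)).

Definition smooth_on U f := forall k, Ck_on U k f.

Definition test_function U f :=
  smooth_on setT f /\
  exists K, [/\ compact K, K `<=` U & forall x, ~ K x -> f x = 0].

End derivatives.

Section slices.
Context (R : realType) (d : nat).

Definition replace_coord (x : 'rV[R]_d) (i : 'I_d) (t : R) : 'rV[R]_d :=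
  \row_j (if j == i then t else x ord0 j).

(* omega_I, with the coordinates in I listed in increasing order *)
Definition subcoords (I : {set 'I_d}) (x : 'rV[R]_d) : 'rV[R]_#|I| :=
  \row_j x ord0 (enum_val j).

(* the point omega with omega_I = t and omega_{-I} = y *)
Definition glue (I : {set 'I_d}) (t : 'rV[R]_#|I|) (y : 'rV[R]_#|~: I|) :
    'rV[R]_d :=
  \sum_j t ord0 j *: delta_mx ord0 (enum_val j) +
  \sum_j y ord0 j *: delta_mx ord0 (enum_val j).

Lemma glueK (I : {set 'I_d}) (x : 'rV[R]_d) :
  glue (subcoords I x) (subcoords (~: I) x) = x.
Proof.
rewrite /glue; under eq_bigr do rewrite mxE.
under [X in _ + X]eq_bigr do rewrite mxE.
rewrite -(big_enum_val (fun i => x ord0 i *: delta_mx ord0 i)).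
rewrite -(big_enum_val (fun i => x ord0 i *: delta_mx ord0 i)).
rewrite [RHS]row_sum_delta [RHS](bigID (mem I))/=; congr (_ + _).
by apply: eq_bigl => i; rewrite inE.
Qed.

End slices.

Section analysis_on_box.
Context (R : realType) (d : nat) (a b : 'rV[R]_d).
Implicit Types (f phi : 'rV[R]_d -> R) (I : {set 'I_d}).

Local Notation S := (box a b).
Local Notation leb := (lebesgue_rV d).

Definition integral_box f : \bar R := (\int[leb]_(x in S) (f x)%:E)%E.

Definition prob_density f :=
  [/\ measurable_fun S f, forall x, S x -> 0 <= f x & integral_box f = 1%E].

Definition expectation_density f phi : \bar R :=
  integral_box (fun x => phi x * f x).

Definition L1_norm phi : \bar R := integral_box (fun x => `|phi x|).

Definition Linf_norm phi : \bar R :=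
  ess_sup (lebesgue_box a b) (fun x => `|phi x|%:E).

Definition in_Linf phi := measurable_fun S phi /\ (Linf_norm phi < +oo)%E.

Definition weak_partial (i : 'I_d) phi g :=
  forall psi, test_function S° psi ->
    integral_box (fun x => phi x * partial i psi x) =
    (- integral_box (fun x => g x * psi x)%R)%E.

Definition in_W1inf phi :=
  in_Linf phi /\ forall i, exists g, in_Linf g /\ weak_partial i phi g.

(* C^k up to the boundary: the partial derivatives of order at most k in the
   interior extend continuously to S. *)
Definition Ck_closure (k : nat) f :=
  [/\ {within S, continuous f}, Ck_on S° k f &
      forall s : seq 'I_d, (size s <= k)%N ->
        exists g, {within S, continuous g} /\
                  forall x, S° x -> g x = partials s f x].

Definition smooth_closure f :=
  exists U g, [/\ open U, S `<=` U, smooth_on U g & forall x, S x -> f x = g x].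

Definition Pi_ (i : 'I_d) phi : 'rV[R]_d -> R := fun x =>
  (b ord0 i - a ord0 i)^-1 *
  \int[lebesgue_measure]_(t in `[a ord0 i, b ord0 i]) phi (replace_coord x i t).

(* \mathcal P_I; the factors commute, so the order of enum I is immaterial. *)
Definition calP I phi : 'rV[R]_d -> R :=
  foldr (fun i g => g \- Pi_ i g) phi (enum I).

Definition calR I phi : 'rV[R]_d -> R := phi \- calP I phi.

Definition centered I phi :=
  forall i, i \in I -> {ae lebesgue_box a b, forall x, Pi_ i phi x = 0}.

Definition Lambda_sl I phi : \bar R :=
  (\big[maxe/-oo]_(i in I)
    ess_sup (lebesgue_box (subcoords (~: [set i]) a) (subcoords (~: [set i]) b))
      (fun y => \int[lebesgue_measure]_(t in `[a ord0 i, b ord0 i])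
                  `|phi (glue (I := [set i]) (const_mx t) y)|%:E))%E.

Definition Lambda_mix I phi : \bar R :=
  ess_sup (lebesgue_box (subcoords (~: I) a) (subcoords (~: I) b))
    (fun y => \int[lebesgue_rV #|I|]_(t in box (subcoords I a) (subcoords I b))
                `|phi (glue t y)|%:E)%E.

Definition charge_integral (nu : {charge set 'rV[R]_d -> \bar R})
    (P N : set 'rV[R]_d) (nuPN : hahn_decomposition nu P N)
    (U : set 'rV[R]_d) psi : \bar R :=
  (\int[jordan_pos nuPN]_(x in U) (psi x)%:E -
   \int[jordan_neg nuPN]_(x in U) (psi x)%:E)%E.

(* nu, restricted to the interior of S, is the i-th distributional derivative
   of f there; what nu does elsewhere is irrelevant. *)
Definition distr_partial (i : 'I_d) f (nu : {charge set 'rV[R]_d -> \bar R})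
    (P N : set 'rV[R]_d) (nuPN : hahn_decomposition nu P N) :=
  forall psi, test_function S° psi ->
    integral_box (fun x => f x * partial i psi x) =
    (- charge_integral nuPN S° psi)%E.

(* |D_i f|(S). The derivative measure is unique when it exists, so the infimum
   is over at most one value; it is +oo when D_i f is not a finite measure. *)
Definition TV_dir (i : 'I_d) f : \bar R :=
  ereal_inf [set v | exists nu P N (nuPN : hahn_decomposition nu P N),
    distr_partial i f nuPN /\ v = charge_variation nuPN S°].

Definition TV I f : \bar R := (\sum_(i in I) TV_dir i f)%E.

Definition TV_all f : \bar R := (\sum_(i < d) TV_dir i f)%E.

Definition in_BV f :=
  leb.-integrable S (EFin \o f) /\
  forall i, exists nu P N (nuPN : hahn_decomposition nu P N),
    distr_partial i f nuPN.

(* \int_S |\partial_I f|; derivatives are taken in the interior of S, whose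
   complement in S is negligible. *)
Definition mixed_variation I f : \bar R :=
  (\int[leb]_(x in S°) `|partials (enum I) f x|%:E)%E.

(* sigma(f, [lo, hi]), nu ranging over the vertices of the unit cube *)
Definition vertex_sum f (lo hi : 'rV[R]_d) : R :=
  \sum_(nu : {ffun 'I_d -> bool})
    (-1) ^+ (\sum_i nu i)%N *
    f (\row_i (hi ord0 i + (nu i)%:R * (lo ord0 i - hi ord0 i))).

(* finite families of boxes, given by their pairs of extreme corners *)
Definition box_partition (Q : seq ('rV[R]_d * 'rV[R]_d)) :=
  let B j := box (nth (0, 0) Q j).1 (nth (0, 0) Q j).2 in
  [/\ forall q, q \in Q -> forall i, q.1 ord0 i < q.2 ord0 i,
      forall j l, (j < size Q)%N -> (l < size Q)%N -> j <> l ->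
        (B j)° `&` (B l)° = set0 &
      \bigcup_(j in [set j | (j < size Q)%N]) B j = S].

Definition vitali_variation f : \bar R :=
  ereal_sup [set (\sum_(q <- Q) `|vertex_sum f q.1 q.2|)%:E |
             Q in box_partition].

End analysis_on_box.

(* Main.v *)
Require Import Defs.
From HB Require Import structures.
From mathcomp Require Import all_boot all_order all_algebra.
From mathcomp Require Import all_classical all_reals all_analysis.
From mathcomp Require Import ess_sup_inf measurable_realfun ring lra zify.
Set Implicit Arguments.
Unset Strict Implicit.
Unset Printing Implicit Defensive.
Import Order.TTheory GRing.Theory Num.Theory.
Import numFieldNormedType.Exports.
Local Open Scope classical_set_scope.
Local Open Scope ring_scope.

(** Why the constants are attained.

    In one variable, if phi has mean zero on [a, b] and f is smooth, then
    int phi f = - int Phi f' for the primitive Phi of phi, and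
    |Phi| <= (1/2) int |phi|.  Equality is approached when f' sits where Phi is
    extremal.  The model case is f = the indicator of [b - w, b] and phi = +1 on
    [b - w, b], -1 on [a, a + w] and 0 in between: there int phi f = w,
    int |phi| = 2 w and the variation of f is 1, which gives the ratio 1/2.

    In d variables take f(x) = prod_(i in I) F_i(x_i), divided by the volume of the
    sides outside I to have integral 1, and phi(x) = prod_(i in I) h_i(x_i), where
    (F_i, h_i) is a copy of the model pair for the i-th side with F_i scaled to
    integral 1.  The width w is the SAME for all sides.  Then E_f[phi] = 1, since phi = 1 on the support of f.
    - Each |D_i f|(S) is 1/w, and |phi| <= 1 makes every slice of phi in a direction
      of I have L^1 norm at most 2 w: the product of the slice envelope and TV_I is
      2 w * k / w = 2 k.  With unequal widths the maximum over i in the slice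
      envelope would lose a factor.  The other directions contribute no variation,
      so TV_infty = TV_I.
    - The mixed envelope is (2 w)^k and the mixed variation is w^-k, with product
      2^k; for I = [d] these are the L^1 norm and the Vitali variation.

    Smooth pairs are obtained from these by approximating the step F by
    nondecreasing polynomials.  All functions are then products of
    one-variable polynomials (tensor below), a class stable under
    partial derivatives, and every functional in the statement reduces to
    one-dimensional integrals.  The lemmas that carry the argument are
    exists_sharpened_sign, exists_step_poly and exists_step_pair (the approximation
    of the model pair), integral_prod_cylinder (Fubini for products),
    tensor_integration_by_parts and exists_distr_partial_tensor (weak and
    distributional derivatives are the classical ones),
    vitali_variation_tensor_le, and exists_near_optimal_pair, which collects
    all bounds with an error factor c < 1 that can be taken as close to 1 as needed.

    For the defect-adjusted bounds phi = 1 and f constant suffice: the projection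
    P_I kills constants, so the first term vanishes and R_I phi = 1. *)

(** * Polynomial approximation of a step *)

Section polynomial_steps.
Context {R : realType}.
Implicit Types (p q F : {poly R}) (a b c : R).

Lemma exists_antideriv p : exists P : {poly R}, P^`() = p.
Proof.
exists (\poly_(i < (size p).+1) (p`_i.-1 / i%:R)).
apply/polyP => i; rewrite coef_deriv coef_poly ltnS /=.
case: ltnP => [ip|pi]; last by rewrite mul0rn nth_default.
by rewrite -[LHS]mulr_natr divfK// pnatr_eq0.
Qed.

Lemma continuous_within_horner (A : set R) p : {within A, continuous (horner p)}.
Proof. by apply: continuous_subspaceT; exact: continuous_horner. Qed.

Lemma integrable_horner a b p :
  lebesgue_measure.-integrable `[a, b] (EFin \o horner p).
Proof.
apply: continuous_compact_integrable; first exact: segment_compact.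
exact: continuous_within_horner.
Qed.

Lemma integral_deriv_horner a b p : a < b ->
  (\int[lebesgue_measure]_(x in `[a, b]) (p^`().[x])%:E)%E
    = (p.[b] - p.[a])%:E.
Proof.
move=> ab; rewrite (@continuous_FTC2 _ _ (horner p))//.
- exact: continuous_within_horner.
- split=> [x _||]; first exact: ex_derive.
  + exact/cvg_at_right_filter/continuous_horner.
  + exact/cvg_at_left_filter/continuous_horner.
- by move=> x _; rewrite derive1E derive_val.
Qed.

Lemma Rintegral_deriv_horner a b p : a < b ->
  \int[lebesgue_measure]_(x in `[a, b]) p^`().[x] = p.[b] - p.[a].
Proof. by move=> ab; rewrite /Rintegral integral_deriv_horner. Qed.

Lemma Rintegral_horner_reflect a b p : a < b ->
  \int[lebesgue_measure]_(x in `[a, b]) p.[a + b - x] =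
  \int[lebesgue_measure]_(x in `[a, b]) p.[x].
Proof.
move=> ab; have [P <-] := exists_antideriv p.
rewrite Rintegral_deriv_horner//.
pose Q := - (P \Po ((a + b)%:P - 'X)).
under eq_Rintegral => x _.
  rewrite (_ : _.[_] = Q^`().[x]); first over.
  rewrite derivN deriv_comp derivB derivC derivX !hornerE horner_comp !hornerE.
  ring.
rewrite Rintegral_deriv_horner// !hornerE !horner_comp !hornerE.
have -> : a + b - b = a by ring.
have -> : a + b - a = b by ring.
ring.
Qed.

(** The n-th iterate of s |-> (3 s - s^3) / 2 converges to the sign of s on [-1, 1].
    With v = 1 - H^2 one iteration replaces v by v^2 (3 + v) / 4 <= v^2, so
    v is at most (1 - s^2)^(n + 1); the last conjunct is a form of this decay that
    needs no powers. *)
Lemma exists_sharpened_sign (n : nat) : exists H : {poly R},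
  forall s : R, -1 <= s <= 1 ->
  [/\ H.[s] ^+ 2 <= 1, 0 <= H^`().[s],
      (s <= 0 -> H.[s] <= 0) /\ (0 <= s -> 0 <= H.[s]) &
      (1 - H.[s] ^+ 2) * (1 + n%:R * s ^+ 2) <= 1].
Proof.
(* s^2 <= H^2, that is v <= 1 - s^2, carries the decay through the induction. *)
suff [H HP] : exists H : {poly R}, forall s : R, -1 <= s <= 1 ->
  [/\ H.[s] ^+ 2 <= 1, 0 <= H^`().[s],
      (s <= 0 -> H.[s] <= 0) /\ (0 <= s -> 0 <= H.[s]), s ^+ 2 <= H.[s] ^+ 2 &
      (1 - H.[s] ^+ 2) * (1 + n%:R * s ^+ 2) <= 1].
  by exists H => s /HP[].
elim: n => [|n [H HP]].
  by exists 'X => s s1; rewrite derivX !hornerE; split => //; nra.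
exists (2^-1 *: (3 *: H - H ^+ 3)) => s s1.
have [H1 H'0 [sn sp] sH2 HV] := HP s s1.
have s2 : s ^+ 2 <= 1 by nra.
rewrite derivZ derivB derivZ deriv_exp !hornerE /=.
move: H1 H'0 sn sp sH2 HV.
set h := H.[s]; set h' := H^`().[s]; set N : R := n%:R => H1 H'0 sn sp sH2 HV.
have N0 : 0 <= N by rewrite ler0n.
have sq : (2^-1 * (3 * h - h ^+ 3)) ^+ 2 =
    1 - (1 - h ^+ 2) ^+ 2 * (1 - h ^+ 2 / 4) by field.
have h2 := sqr_ge0 h.
have v' : (1 - h ^+ 2) ^+ 2 * (1 - h ^+ 2 / 4) <= (1 - h ^+ 2) * (1 - s ^+ 2).
  rewrite expr2 -mulrA ler_wpM2l ?subr_ge0// (@le_trans _ _ (1 - h ^+ 2))//;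
    last lra.
  by rewrite ler_piMr ?subr_ge0//; lra.
have hE : 2^-1 * (3 * h - h ^+ 3) = h * ((3 - h ^+ 2) / 2) by field.
split.
- rewrite sq lerBlDr lerDl mulr_ge0 ?sqr_ge0//; lra.
- have -> : 2^-1 * (3 * h' - (h' * h * h + h' * h * h + h' * h * h)) =
      3 / 2 * ((1 - h ^+ 2) * h') by field.
  by rewrite !mulr_ge0 ?subr_ge0.
- rewrite hE; split=> [/sn|/sp] h0.
  + by rewrite mulr_le0_ge0//; lra.
  + by rewrite mulr_ge0//; lra.
- by rewrite sq; nra.
rewrite sq opprB addrCA subrr addr0.
have -> : n.+1%:R * s * s = (N + 1) * s ^+ 2.
  by rewrite -natr1 expr2 mulrA.
have : (1 - h ^+ 2) * (1 - s ^+ 2) * (1 + (N + 1) * s ^+ 2) <= 1.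
  apply: le_trans HV; rewrite -mulrA ler_wpM2l ?subr_ge0//.
  have := sqr_ge0 s; nra.
apply: le_trans; apply: ler_wpM2r; last exact: v'.
have := sqr_ge0 s; nra.
Qed.

(** An increasing polynomial that imitates the indicator of [c, b].  Only the size of
    F (1 - F) is recorded: it controls both the L^1 distance to the indicator and the
    loss of F^2 against F. *)
Lemma exists_step_poly a b c (e : R) : a < c < b -> 0 < e -> exists F : {poly R},
  (forall x, a <= x <= b -> [/\ 0 <= F.[x] <= 1, 0 <= F^`().[x],
     (x <= c -> F.[x] <= 2^-1) & (c <= x -> 2^-1 <= F.[x])]) /\
  \int[lebesgue_measure]_(x in `[a, b]) (F * (1 - F)).[x] <= e.
Proof.
move=> /andP[ac cb] e0; pose L := b - a.
have ab := lt_trans ac cb.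
have L0 : 0 < L by rewrite /L; lra.
(* With this n, 4 F (1 - F) is at most 2 e / L outside [c - e, c + e]. *)
pose n := Num.truncn (L ^+ 3 / e ^+ 3).
have nL : L ^+ 3 / e ^+ 3 <= n.+1%:R by apply/ltW/truncnS_gt.
have [H HP] := exists_sharpened_sign n.+1.
pose F := 2^-1 *: (1 + (H \Po (L^-1 *: ('X - c%:P)))).
have FE x : F.[x] = (1 + H.[(x - c) / L]) / 2.
  by rewrite !hornerE horner_comp !hornerE mulrC (mulrC L^-1).
have F'E x : F^`().[x] = H^`().[(x - c) / L] / L / 2.
  rewrite /F derivZ derivD deriv_comp -polyC1 derivC derivZ derivB derivX derivC.
  rewrite !hornerE horner_comp !hornerE (mulrC L^-1 (x - c))/=; ring.
clearbody F.
have s1 x : a <= x <= b -> -1 <= (x - c) / L <= 1.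
  by move=> /andP[ax xb]; rewrite ler_pdivlMr// ler_pdivrMr// /L; lra.
exists F; split.
  move=> x xab; have [H1 H'0 [sn sp] _] := HP _ (s1 _ xab).
  rewrite !FE F'E; split.
  - nra.
  - by rewrite !divr_ge0// ltW.
  - move=> xc; have : (x - c) / L <= 0 by rewrite pmulr_lle0 ?invr_gt0// subr_le0.
    by move=> /sn; lra.
  - move=> xc; have : 0 <= (x - c) / L by apply: divr_ge0; [lra|exact: ltW].
    by move=> /sp; lra.
pose K := (1 + n.+1%:R * (e / L) ^+ 2)^-1.
have Kp : 0 < 1 + n.+1%:R * (e / L) ^+ 2.
  by rewrite ltr_pwDl// mulr_ge0// sqr_ge0.
have K0 : 0 < K by rewrite invr_gt0.
have bnd x : x \in `[a, b] ->
    ((F * (1 - F)).[x] <= 4^-1 * (K + \1_(`[c - e, c + e]) x)).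
  rewrite in_itv/= => xab; have [H1 _ _ HV] := HP _ (s1 _ xab).
  rewrite !hornerE FE; set h := H.[_] in H1 HV *.
  rewrite (_ : (1 + h) / 2 * (1 - (1 + h) / 2) = 4^-1 * (1 - h ^+ 2)); last by field.
  rewrite ler_pM2l// indicE; case: (boolP (x \in _)) => [_|].
    by have := sqr_ge0 h; rewrite /=; lra.
  rewrite notin_setE /= in_itv/= => xA.
  rewrite addr0 -[K]mul1r ler_pdivlMr//.
  apply: le_trans HV; rewrite ler_wpM2l ?subr_ge0// lerD2l ler_wpM2l//.
  rewrite !expr_div_n ler_pM2r ?invr_gt0 ?exprn_gt0//.
  have [xc|xc] := ltP x (c - e); first by nra.
  have [cx|cx] := ltP (c + e) x; first by nra.
  by exfalso; apply: xA; apply/andP.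
have D0 x : `[a, b]%classic x -> 0 <= (F * (1 - F)).[x].
  rewrite /= in_itv/= => /s1/HP[H1 _ _ _].
  rewrite !hornerE FE; set h := H.[_] in H1 *.
  rewrite (_ : (1 + h) / 2 * (1 - (1 + h) / 2) = 4^-1 * (1 - h ^+ 2)); last by field.
  by rewrite mulr_ge0 ?subr_ge0.
rewrite -lee_fin /Rintegral fineK; last first.
  by apply: integrable_fin_num => //; exact: integrable_horner.
apply: (@le_trans _ _ (\int[lebesgue_measure]_(x in `[a, b])
    ((4^-1)%:E * (K%:E + (\1_(`[c - e, c + e]) x)%:E)))%E).
  apply: ge0_le_integral => //=.
  - exact: measurable_int (integrable_horner _ _ _).
  - apply: measurable_funeM; apply/measurable_EFinP.
    by apply: measurable_funD => //; exact: measurable_indic.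
have mI : measurable_fun `[a, b] (fun x => (\1_(`[c - e, c + e]) x : R)%:E).
  by apply/measurable_EFinP; exact: measurable_indic.
rewrite ge0_integralZl//=; last 2 first.
- by apply: emeasurable_funD.
- by move=> x _; rewrite -EFinD lee_fin addr_ge0// ltW.
rewrite ge0_integralD//=; last by move=> x _; rewrite lee_fin ltW.
rewrite integral_cst//= integral_indic//=.
rewrite lebesgue_measure_itv/= lte_fin ab -EFinD.
have mA : (lebesgue_measure (`[(c - e)%R, (c + e)%R] `&` `[a, b] : set R)
    <= (2 * e)%R%:E)%E.
  apply: (@le_trans _ _ (lebesgue_measure (`[(c - e)%R, (c + e)%R] : set R))).
    by apply: le_measure => //; rewrite inE; [exact: measurableI|].
  rewrite lebesgue_measure_itv/= lte_fin ltrD2l gtrN// -EFinD lee_fin; lra.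
apply: (@le_trans _ _ ((4^-1)%:E * ((K * L)%R%:E + (2 * e)%R%:E))%E).
  by rewrite lee_pmul2l// EFinM leeD2l.
rewrite -EFinD -EFinM lee_fin.
suff : K * L <= 2 * e by lra.
rewrite mulrC ler_pdivrMr//.
have : L <= e * (n.+1%:R * (e / L) ^+ 2); last by lra.
move: nL; rewrite ler_pdivrMr ?exprn_gt0// => nL.
rewrite -(@ler_pM2r _ (L ^+ 2)) ?exprn_gt0//.
rewrite (_ : e * _ * _ = n.+1%:R * e ^+ 3); last by field; rewrite gt_eqF.
by rewrite -exprS.
Qed.

(** The model pair up to the factor C: G is F divided by its integral, where F
    imitates the indicator of [b - w, b], and h(x) = F(x) - F(a + b - x), which is
    odd about the midpoint and hence centered.  The width w bounds the L^1 norm of h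
    from above and the inverse of the increase of G from below, with no reference
    to b - a: this is what allows one width for all sides of a box. *)
Lemma exists_step_pair (a b w C : R) : 0 < w -> w <= (b - a) / 2 -> 0 < C < 1 ->
  exists G h : {poly R},
  [/\ forall x, a <= x <= b -> [/\ 0 <= G.[x], 0 <= G^`().[x] & `|h.[x]| <= 1],
      \int[lebesgue_measure]_(x in `[a, b]) h.[x] = 0 /\
      \int[lebesgue_measure]_(x in `[a, b]) G.[x] = 1,
      C * \int[lebesgue_measure]_(x in `[a, b]) `|h.[x]| <= 2 * w,
      C * w * (G.[b] - G.[a]) <= 1 &
      C <= \int[lebesgue_measure]_(x in `[a, b]) (h * G).[x]].
Proof.
move=> w0 wab /andP[C0 C1].
have ab : a < b by lra.
(* The losses below add up to at most 5 e, which must stay below (w / 2) (1 - C). *)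
pose c := b - w; pose e : R := w * (1 - C) / 10.
have e0 : 0 < e by rewrite divr_gt0// mulr_gt0// subr_gt0.
have acb : a < c < b by rewrite /c; lra.
have [F [FP FD]] := exists_step_poly acb e0.
pose refl p : {poly R} := p \Po ((a + b)%:P - 'X).
have reflE p x : (refl p).[x] = p.[a + b - x] by rewrite horner_comp !hornerE.
pose Fr : {poly R} := refl F.
have FrE x : Fr.[x] = F.[a + b - x] by rewrite reflE.
have rab x : a <= x <= b -> a <= a + b - x <= b by lra.
pose D (p : {poly R}) := \int[lebesgue_measure]_(x in `[a, b]) p.[x].
have Dle p q : (forall x, a <= x <= b -> p.[x] <= q.[x]) -> D p <= D q.
  move=> pq; apply: le_Rintegral => //.
  1,2: exact: integrable_horner.
have DD p q : D (p + q) = D p + D q.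
  rewrite /D; under eq_Rintegral do rewrite hornerD.
  by rewrite RintegralD//; exact: integrable_horner.
have DZ (k : R) p : D (k *: p) = k * D p.
  rewrite /D; under eq_Rintegral do rewrite hornerZ.
  by rewrite RintegralZl//; exact: integrable_horner.
have Drefl p : D (refl p) = D p.
  rewrite /D; under eq_Rintegral do rewrite reflE.
  exact: Rintegral_horner_reflect.
pose m := D F; pose A : {poly R} := F * (1 - F).
have DA : D A <= e by [].
(* |F - 1_[c, b]| <= 2 F (1 - F), because F <= 1/2 before c and F >= 1/2 after. *)
have [mw wm] : m <= w + 2 * e /\ w <= m + 2 * e.
  have Iw : \int[lebesgue_measure]_(x in `[a, b]) \1_(`[c, b]) x = w.
    rewrite /Rintegral integral_indic// setIidl; last first.
      by apply: subset_itvr; rewrite bnd_simp; lra.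
    suff E : lebesgue_measure (`[c, b]%classic : set R) = w%:E.
      exact: (congr1 fine E).
    have cb : c < b by rewrite /c; lra.
    by rewrite lebesgue_measure_itv/= lte_fin cb -EFinD /c subKr.
  have iI : lebesgue_measure.-integrable `[a, b] (EFin \o \1_(`[c, b])).
    exact: integrableS (integrable_indic_itv _ _ _ _).
  have D2A : D (2 *: A) <= 2 * e by rewrite DZ ler_pM2l.
  have ptw x : a <= x <= b ->
      F.[x] <= \1_(`[c, b]) x + (2 *: A).[x] /\
      \1_(`[c, b]) x <= F.[x] + (2 *: A).[x].
    move=> xab; have [/andP[F0 F1] _ Fl Fg] := FP _ xab.
    rewrite indicE /A !hornerE; case: (boolP (x \in _)) => /=.
      rewrite inE/= in_itv/= => /andP[/Fg].
      by split; nra.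
    rewrite notin_setE /= in_itv/= => xc.
    have /Fl : x <= c.
      case: (leP x c) => // cx; exfalso; apply: xc.
      by rewrite (ltW cx); case/andP: xab.
    by split; nra.
  split.
  - rewrite -Iw; apply: (@le_trans _ _ (\int[lebesgue_measure]_(x in `[a, b])
        (\1_(`[c, b]) x + (2 *: A).[x]))).
      apply: le_Rintegral => //.
      + exact: integrable_horner.
      + by refine (integrableD _ iI (integrable_horner a b (2 *: A))).
      + by move=> x /=; rewrite in_itv/= => /ptw[].
    by rewrite RintegralD//; [rewrite lerD2l|exact: integrable_horner].
  - rewrite -Iw; apply: (@le_trans _ _ (D (F + 2 *: A))).
      apply: le_Rintegral => //; first exact: integrable_horner.
      by move=> x /=; rewrite in_itv/= hornerD => /ptw[].
    by rewrite DD lerD2l.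
have mlow : w * (1 + C) / 2 <= m by move: wm; rewrite /e; nra.
have m0 : 0 < m by apply: lt_le_trans mlow; rewrite divr_gt0// mulr_gt0// addr_gt0.
exists (m^-1 *: F), (F - Fr); split.
- move=> x xab; have [/andP[F0 F1] F'0 _ _] := FP _ xab.
  have [/andP[r0 r1] _ _ _] := FP _ (rab _ xab).
  rewrite derivZ !hornerE FrE !mulr_ge0 ?invr_ge0 ?(ltW m0)//; split => //.
  by rewrite ler_norml; lra.
- split; last by rewrite -/(D _) DZ mulVf// gt_eqF.
  by rewrite -/(D _) -scaleN1r DD DZ Drefl mulN1r subrr.
- have : \int[lebesgue_measure]_(x in `[a, b]) `|(F - Fr).[x]| <= D (F + Fr).
    apply: le_Rintegral => //; [|exact: integrable_horner|].
      exact: integrable_norm (integrable_horner _ _ _).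
    move=> x /=; rewrite in_itv/= => xab.
    have [/andP[F0 F1] _ _ _] := FP _ xab.
    have [/andP[r0 r1] _ _ _] := FP _ (rab _ xab).
    by rewrite !hornerE FrE ler_norml; lra.
  rewrite DD Drefl -/m; set J := Rintegral _ _ _ => Jm.
  move: mw; rewrite /e; nra.
- have [/andP[a0 a1] _ _ _] := FP a (introT andP (conj (lexx _) (ltW ab))).
  have [/andP[b0 b1] _ _ _] := FP b (introT andP (conj (ltW ab) (lexx _))).
  rewrite !hornerE -mulrBr mulrCA ler_pdivrMl// mulr1.
  apply: (@le_trans _ _ (C * w)); last by nra.
  by rewrite ler_piMr ?mulr_ge0 ?(ltW C0) ?(ltW w0)//; lra.
rewrite -/(D _) -scalerAr DZ ler_pdivlMl//.
(* F Fr is small: since w <= (b - a) / 2, at each point F or its reflection Fr is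
   taken on the side where the step has not yet occurred. *)
have : D F <= D ((F - Fr) * F) + D (3 *: A + 2 *: refl A).
  rewrite -DD; apply: Dle => x xab.
  have [/andP[F0 F1] _ Fl Fg] := FP _ xab.
  have [/andP[r0 r1] _ rl rg] := FP _ (rab _ xab).
  rewrite /A !hornerE reflE !hornerE FrE /=.
  suff : F.[a + b - x] * F.[x] <= 2 * (F.[x] * (1 - F.[x]))
      + 2 * (F.[a + b - x] * (1 - F.[a + b - x])) by lra.
  move: F0 F1 r0 r1 Fl rl; set u := F.[x]; set v := F.[a + b - x].
  move=> u0 u1 v0 v1 ul vl.
  have uu : 0 <= u * (1 - u) by rewrite mulr_ge0 ?subr_ge0.
  have vv : 0 <= v * (1 - v) by rewrite mulr_ge0 ?subr_ge0.
  have [xc|cx] := leP x c.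
    have uh : 0 <= u * (2^-1 - u) by rewrite mulr_ge0 ?subr_ge0 ?ul.
    have : v * u <= u by rewrite ler_piMl.
    lra.
  have vh : 0 <= v * (2^-1 - v).
    by rewrite mulr_ge0 ?subr_ge0 ?vl//; move: cx; rewrite /c; lra.
  have : v * u <= v by rewrite ler_piMr.
  lra.
have mC : 0 <= (m - w / 2) * (1 - C).
  by apply: mulr_ge0; [have := mulr_gt0 w0 C0; lra|lra].
by rewrite !DD !DZ Drefl -/m; move: DA mC; rewrite /e; lra.
Qed.

End polynomial_steps.

(** * Iterated integrals on row vectors *)

Section lebesgue_rV_integral.
Context {R : realType}.
Local Notation leb1 := (@lebesgue_measure R).

Lemma integrable_rVS n (f : 'rV[R]_n.+1 -> \bar R) : measurable_fun setT f ->
  (lebesgue_rV n.+1).-integrable setT f <->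
  (leb1 \x lebesgue_rV n)%E.-integrable setT (f \o (@rV_cons R n)).
Proof.
move=> mf; have mfc : measurable_fun setT (f \o (@rV_cons R n)).
  by apply: measurableT_comp => //; exact: measurable_rV_cons.
have E : (\int[lebesgue_rV n.+1]_x `|f x| =
    \int[leb1 \x lebesgue_rV n]_z `|(f \o (@rV_cons R n)) z|)%E.
  rewrite [LHS](@ge0_integral_pushforward _ _ _ _ _ _ (@measurable_rV_cons R n)
    (leb1 \x lebesgue_rV n)%E setT (fun x => `|f x|%E))//.
  exact: measurableT_comp.
by split=> /integrableP[_ foo]; apply/integrableP; split => //;
  move: foo; rewrite E.
Qed.

Lemma integral_rVS n (f : 'rV[R]_n.+1 -> \bar R) :
  (lebesgue_rV n.+1).-integrable setT f ->
  (\int[lebesgue_rV n.+1]_x f x =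
   \int[leb1 \x lebesgue_rV n]_z f (rV_cons z))%E.
Proof.
move=> intf; have mf := measurable_int _ intf.
apply: (@integral_pushforward _ _ _ _ _ _ (@measurable_rV_cons R n)
  (leb1 \x lebesgue_rV n)%E setT f mf) => //.
by rewrite preimage_setT; exact/(integrable_rVS mf).
Qed.

Lemma measurable_fun_prod_rV n (g : 'I_n -> R -> R) :
  (forall i, measurable_fun setT (g i)) ->
  measurable_fun setT (fun x : 'rV[R]_n => \prod_i g i (x ord0 i)).
Proof.
move=> mg; apply: measurable_prod => i _.
by apply: measurableT_comp (mg i) _; exact: measurable_coord_rV.
Qed.

(** Signed factors are allowed, which is why integrability is part of the
    induction. *)
Lemma integral_prod_rV n (g : 'I_n -> R -> R) :
  (forall i, leb1.-integrable setT (EFin \o g i)) ->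
  (lebesgue_rV n).-integrable setT
    (fun x => (\prod_i g i (x ord0 i))%:E) /\
  (\int[lebesgue_rV n]_x (\prod_i g i (x ord0 i))%:E =
   (\prod_i \int[leb1]_t g i t)%:E)%E.
Proof.
elim: n g => [|n ih] g intg.
  have E (x : 'rV[R]_0) : (\prod_i g i (x ord0 i))%:E = 1%E.
    by rewrite big_ord0.
  under [X in (integrable _ _ X)]eq_fun do rewrite E.
  under eq_integral do rewrite E.
  rewrite big_ord0 integral_cst//= mul1e diracT; split => //.
  apply/integrableP; split => //.
  by under eq_integral do rewrite abse1; rewrite integral_cst//= mul1e diracT ltry.
have mg i : measurable_fun setT (g i).
  by apply/measurable_EFinP; exact: measurable_int (intg i).
have [inty Ey] := ih (fun j => g (lift ord0 j)) (fun j => intg _).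
set P := fun y : 'rV[R]_n => \prod_j g (lift ord0 j) (y ord0 j).
have consE t y : \prod_i g i (rV_cons (t, y) ord0 i) = g ord0 t * P y.
  rewrite big_ord_recl mxE unlift_none; congr (_ * _).
  by apply: eq_bigr => j _; rewrite mxE liftK.
have mP : measurable_fun setT (fun x : 'rV[R]_n.+1 => (\prod_i g i (x ord0 i))%:E).
  by apply/measurable_EFinP; exact: measurable_fun_prod_rV.
have mPc : measurable_fun setT
    ((fun x : 'rV[R]_n.+1 => (\prod_i g i (x ord0 i))%:E) \o (@rV_cons R n)).
  by apply: measurableT_comp => //; exact: measurable_rV_cons.
have intP : (lebesgue_rV n.+1).-integrable setT
    (fun x => (\prod_i g i (x ord0 i))%:E).
  apply/(integrable_rVS mP)/(integrable12ltyP _ _ mPc) => /=.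
  have /integrableP[_ aP] := inty; have /integrableP[_ a0] := intg ord0.
  under eq_integral do under eq_integral do rewrite consE normrM EFinM.
  under eq_integral.
    move=> t _; rewrite ge0_integralZl//; first over.
    apply/measurable_EFinP; apply: measurableT_comp => //.
    by apply/measurable_EFinP; exact: measurable_int inty.
  rewrite ge0_integralZr//.
  - by rewrite lte_mul_pinfty// ?integral_ge0// ge0_fin_numE// integral_ge0.
  - by do 2 apply: measurableT_comp => //; exact: mg.
  - exact: integral_ge0.
split => //.
rewrite integral_rVS// -integral12_prod_meas1; last exact/(integrable_rVS mP).
rewrite /fubini_F.
under eq_integral.
  move=> t _; under eq_integral do rewrite consE EFinM.
  rewrite integralZl// Ey; over.
rewrite /= integralZr//; last exact: intg.
rewrite big_ord_recl EFinM; congr (_ * _)%E.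
by rewrite /Rintegral fineK//; apply: integrable_fin_num => //; exact: intg.
Qed.

(** Fubini with the i-th variable integrated first.  The measure is built by peeling
    off the coordinate 0, so for i > 0 the claim is the induction hypothesis applied
    to almost every slice. *)
Lemma integral_rV_slices0 n (i : 'I_n) (f : 'rV[R]_n -> \bar R) :
  (lebesgue_rV n).-integrable setT f ->
  (forall x, (\int[leb1]_t f (replace_coord x i t) = 0)%E) ->
  (\int[lebesgue_rV n]_x f x = 0)%E.
Proof.
elim: n i f => [[]//|n ih] i f intf f0.
have mf := measurable_int _ intf.
have intc := (integrable_rVS mf).1 intf.
rewrite integral_rVS//.
have [j ij|i0] := unliftP ord0 i; last first.
  rewrite -integral21_prod_meas1//; apply: integral0_eq => y _.
  rewrite /fubini_G -[RHS](f0 (rV_cons (0, y))); apply: eq_integral => t _.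
  congr f; apply/rowP => k; rewrite !mxE /= i0.
  by case: unliftP => [l ->|->]; rewrite ?eqxx// eq_sym (negbTE (neq_lift _ _)).
rewrite -integral12_prod_meas1//.
rewrite (ae_eq_integral (cst 0%E))//; last 2 first.
- exact: (measurable_fubini_F intc).
- have := ae_integrable1 intc; apply: filterS => t intt _.
  rewrite /fubini_F /=; apply: (ih j) => // y.
  rewrite -[RHS](f0 (rV_cons (t, y))); apply: eq_integral => s _.
  congr f; apply/rowP => k; rewrite !mxE /= ij.
  case: unliftP => [l ->|->]; last by rewrite (negbTE (neq_lift _ _)).
  by rewrite /= mxE (inj_eq lift_inj).
exact: integral0.
Qed.

End lebesgue_rV_integral.

(** * Boxes and continuous functions *)

Section boxes.
Context {R : realType}.
Local Notation leb1 := (@lebesgue_measure R).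

Lemma measurable_cylinder n (A : 'I_n -> set R) :
  (forall i, measurable (A i)) ->
  measurable [set x : 'rV[R]_n | forall i, A i (x ord0 i)].
Proof.
move=> mA; rewrite (_ : mkset _ = \bigcap_(i in [set: 'I_n])
    ((fun x : 'rV[R]_n => x ord0 i) @^-1` A i)).
  apply: fin_bigcap_measurable => // i _; rewrite -[X in measurable X]setTI.
  exact: measurable_coord_rV.
by apply/seteqP; split => x Ax i; [move=> _|]; exact: Ax.
Qed.

Lemma integral_prod_cylinder n (A : 'I_n -> set R) (g : 'I_n -> R -> R) :
  (forall i, measurable (A i)) ->
  (forall i, leb1.-integrable (A i) (EFin \o g i)) ->
  let B := [set x : 'rV[R]_n | forall i, A i (x ord0 i)] in
  (lebesgue_rV n).-integrable B (fun x => (\prod_i g i (x ord0 i))%:E) /\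
  (\int[lebesgue_rV n]_(x in B) (\prod_i g i (x ord0 i))%:E =
   (\prod_i \int[leb1]_(t in A i) g i t)%:E)%E.
Proof.
move=> mA intg B; have mB : measurable B by exact: measurable_cylinder.
have E : (fun x : 'rV[R]_n => (\prod_i g i (x ord0 i))%:E) \_ B =
    (fun x => (\prod_i (g i \_ (A i)) (x ord0 i))%:E).
  apply/funext => x; rewrite patchE; case: ifPn => [|/negP xB].
    rewrite inE => Bx; congr EFin; apply: eq_bigr => i _.
    by rewrite patchE mem_set//; exact: Bx.
  have [i xi] : exists i, ~ A i (x ord0 i).
    by apply/existsNP => Bx; apply: xB; rewrite inE.
  by rewrite (bigD1 i)//= patchE memNset// mul0r.
have intA i : leb1.-integrable setT (EFin \o (g i \_ (A i))).
  rewrite -restrict_EFin.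
  exact: ((integrable_mkcond (mu := leb1) _
    (mA i : measurable (A i : set (measurableTypeR R)))).1 (intg i)).
have [intP EP] := integral_prod_rV intA.
split; first by apply: ((integrable_mkcond _ mB).2); rewrite E.
rewrite integral_mkcond E EP; congr EFin; apply: eq_bigr => i _.
by rewrite [RHS]Rintegral_mkcond.
Qed.

(** The sigma-algebra is the one generated by the coordinates, so this needs an
    argument: f is the pointwise limit of its values at grid points of mesh
    1 / (k + 1), and each of these functions takes countably many values, on
    half-open cubes. *)
Lemma continuous_measurable_rV n (f : 'rV[R]_n -> R) :
  continuous f -> measurable_fun setT f.
Proof.
move=> cf.
pose z k (x : 'rV[R]_n) : 'rV[int]_n := \row_j Num.floor (x ord0 j * k.+1%:R).
pose r k (u : 'rV[int]_n) : 'rV[R]_n := \row_j ((u ord0 j)%:~R / k.+1%:R).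
apply: (@measurable_fun_cvg _ _ _ _ (fun k x => f (r k (z k x)))).
  move=> k _ Y mY; rewrite setTI.
  rewrite (_ : _ @^-1` _ =
      \bigcup_(u in [set u | Y (f (r k u))]) (z k @^-1` [set u])); last first.
    by apply/seteqP; split => [x Yx|x [u Yu /= ->]//]; exists (z k x).
  rewrite bigcup_mkcond; apply: countable_bigcupT_measurable.
    exact: countableP.
  move=> u; case: ifP => // _.
  pose A i : set R :=
    `[(u ord0 i)%:~R / k.+1%:R, (u ord0 i + 1)%:~R / k.+1%:R[%classic.
  rewrite (_ : (z k @^-1` [set u])%classic =
      [set x : 'rV[R]_n | forall i, A i (x ord0 i)]); last first.
    apply/seteqP; split => x /=.
      move=> zu i; rewrite /A -zu /= in_itv/= !mxE.
      by rewrite ler_pdivrMr// ltr_pdivlMr// floor_itv.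
    move=> Ax; apply/rowP => i; rewrite !mxE; apply/eqP; rewrite floor_eq.
    by have := Ax i; rewrite /A /= in_itv/= ler_pdivrMr// ltr_pdivlMr//.
  by apply: measurable_cylinder => i; exact: measurable_itv.
move=> x _.
apply: (@cvg_comp _ _ _ (fun k => r k (z k x)) f _ (nbhs x) _ _ (cf x)).
apply/cvg_ballP => e e0; near=> k; split=> // i j.
rewrite /ball/= !mxE !ord1; set y := x _ _.
have k0 : 0 < k.+1%:R :> R by [].
have /andP[fl fu] := floor_itv (y * k.+1%:R).
have dE : y - (Num.floor (y * k.+1%:R))%:~R / k.+1%:R =
    (y * k.+1%:R - (Num.floor (y * k.+1%:R))%:~R) / k.+1%:R.
  by rewrite mulrBl mulfK// gt_eqF.
rewrite dE ger0_norm ?divr_ge0 ?subr_ge0// (@le_lt_trans _ _ (k.+1%:R^-1))//.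
  by rewrite ler_piMl ?invr_ge0// lerBlDl -intrD1 ltW.
near: k; exact: near_infty_natSinv_lt (PosNum e0).
Unshelve. all: by end_near. Qed.

Lemma box_cylinder n (a b : 'rV[R]_n) :
  box a b = [set x | forall i, `[a ord0 i, b ord0 i]%classic (x ord0 i)].
Proof. by apply/seteqP; split => x bx i; have := bx i; rewrite /= in_itv. Qed.

Lemma interior_box n (a b : 'rV[R]_n) : (box a b)° =
  [set x | forall i, `]a ord0 i, b ord0 i[%classic (x ord0 i)].
Proof.
apply/seteqP; split => x.
  move=> /nbhs_ballP[e /= e0 xe] i.
  have e2 : 0 < e / 2 by rewrite divr_gt0.
  have ball s : `|s| < e -> ball x e (x + s *: delta_mx ord0 i).
    move=> se; split => // k j; rewrite /ball/= !mxE opprD addrA subrr sub0r normrN.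
    by case: (_ && _); rewrite ?mulr1// mulr0 normr0.
  have /ball/xe/(_ i) : `|e / 2| < e by rewrite gtr0_norm// ltr_pdivrMr//; lra.
  have /ball/xe/(_ i) : `|- (e / 2)| < e by rewrite normrN gtr0_norm//; lra.
  by rewrite !mxE !eqxx in_itv /=; lra.
move=> xab; rewrite /interior /=.
have : nbhs x (fun y : 'rV[R]_n =>
    forall i, `]a ord0 i, b ord0 i[%classic (y ord0 i)).
  refine (@filter_forall _ _
    (fun i (y : 'rV[R]_n) => `]a ord0 i, b ord0 i[%classic (y ord0 i))
    (nbhs x) _ _) => i.
  have : open_nbhs (x ord0 i) `]a ord0 i, b ord0 i[%classic.
    by split; [exact: interval_open|exact: xab].
  move=> /open_nbhs_nbhs.
  exact: (@coord_continuous R 1 n ord0 i).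
apply: filterS => y yab i; have := yab i; rewrite /= in_itv/= => /andP[ay yb].
by rewrite !ltW.
Qed.

Lemma compact_box n (a b : 'rV[R]_n) : compact (box a b).
Proof.
rewrite (box_cylinder a b).
apply: (@rV_compact R n (fun i => `[a ord0 i, b ord0 i]%classic)) => i.
exact: segment_compact.
Qed.

Lemma bounded_continuous_box n (a b : 'rV[R]_n) (f : 'rV[R]_n -> R) :
  continuous f -> exists M, forall x, box a b x -> `|f x| <= M.
Proof.
move=> cf; have := compact_bounded
  (continuous_compact (continuous_subspaceT cf) (@compact_box n a b)).
move=> [M [_ /(_ (M + 1))]]; rewrite ltrDl => /(_ ltr01) fM.
by exists (M + 1) => x bx; apply: fM; exists x.
Qed.

Lemma integrable_continuous_box n (a b : 'rV[R]_n) (f : 'rV[R]_n -> R) :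
  (forall i, a ord0 i <= b ord0 i) -> continuous f ->
  (lebesgue_rV n).-integrable (box a b) (EFin \o f).
Proof.
move=> ab cf; apply: measurable_bounded_integrable.
- exact: measurable_box.
- have := ltry (\prod_(i < n) (b ord0 i - a ord0 i)).
  by rewrite -(lebesgue_rV_box ab).
- exact: measurable_funTS (continuous_measurable_rV cf).
have [M fM] := bounded_continuous_box a b cf.
exists M; split; first exact: num_real.
by move=> N MN x bx; exact: le_trans (fM _ bx) (ltW MN).
Qed.

End boxes.

(** * Products of one-variable polynomials *)

Section tensor_polynomials.
Context {R : realType} {d : nat}.
Implicit Types (x y : 'rV[R]_d) (p : 'I_d -> {poly R}) (i j : 'I_d).

Lemma replace_coordE x i t :
  replace_coord x i t = x + (t - x ord0 i) *: delta_mx ord0 i.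
Proof.
apply/rowP => j; rewrite !mxE eqxx; case: eqP => [->|_] /=.
  by rewrite mulr1 addrC subrK.
by rewrite mulr0 addr0.
Qed.

Lemma continuous_replace_coord x i : continuous (replace_coord x i).
Proof.
move=> t; rewrite (_ : replace_coord x i =
    fun t => x + (t - x ord0 i) *: delta_mx ord0 i).
  apply: cvgD; first exact: cvg_cst.
  apply: cvgZl.
  by apply: cvgB; [exact: cvg_id|exact: cvg_cst].
by apply/funext => s; exact: replace_coordE.
Qed.

(** The difference quotients along the i-th basis vector are those of the slice, as
    functions of the increment: derivability and derivatives transfer both ways. *)
Lemma difference_quotient_slice (F : 'rV[R]_d -> R) x i t :
  (fun h : R => h^-1 *: ((F \o shift (replace_coord x i t)) (h *: delta_mx ord0 i)
     - F (replace_coord x i t))) =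
  (fun h : R => h^-1 *: (((fun s => F (replace_coord x i s)) \o shift t) (h *: 1)
     - F (replace_coord x i t))).
Proof.
apply/funext => h; congr (_ *: (F _ - _)); apply/rowP => j /=.
rewrite !mxE eqxx /= [h *: 1]mulr1.
by case: eqP => _; rewrite ?mulr1 ?mulr0 ?add0r.
Qed.

Lemma is_derive_slice (F : 'rV[R]_d -> R) x i t :
  derivable F (replace_coord x i t) (delta_mx ord0 i) ->
  is_derive t 1 (fun s => F (replace_coord x i s))
    (partial i F (replace_coord x i t)).
Proof.
move=> dF; apply: DeriveDef.
  by rewrite /derivable -difference_quotient_slice.
by rewrite /partial /derive -difference_quotient_slice.
Qed.

Lemma is_derive_of_slice (F : 'rV[R]_d -> R) x i (l : R) :
  is_derive (x ord0 i) 1 (fun s => F (replace_coord x i s)) l ->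
  is_derive x (delta_mx ord0 i) F l.
Proof.
have xE : replace_coord x i (x ord0 i) = x.
  by rewrite replace_coordE subrr scale0r addr0.
have := difference_quotient_slice F x i (x ord0 i); rewrite xE => E [dF Dl].
apply: DeriveDef.
  by move: dF; rewrite /derivable E /= xE.
by move: Dl; rewrite /derive E /= xE.
Qed.

Definition tensor p x : R := \prod_i (p i).[x ord0 i].

Definition tensor_deriv i p : 'I_d -> {poly R} :=
  fun j => if j == i then (p j)^`() else p j.

Lemma tensor_replace p x i t :
  tensor p (replace_coord x i t) = (p i).[t] * \prod_(j | j != i) (p j).[x ord0 j].
Proof.
rewrite /tensor (bigD1 i)//= mxE eqxx; congr (_ * _).
by apply: eq_bigr => j /negbTE ji; rewrite mxE ji.
Qed.

Lemma continuous_tensor p : continuous (tensor p).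
Proof.
apply: (@continuous_big R 'I_d *%R 1 predT _ 'rV[R]_d (index_enum 'I_d)
  (fun i x => (p i).[x ord0 i])) => [|i _ x].
  exact: mul_continuous.
apply: (@cvg_comp _ _ _ (fun y : 'rV[R]_d => y ord0 i) (horner (p i)) _
  (nbhs (x ord0 i))).
  exact: coord_continuous.
exact: continuous_horner.
Qed.

Lemma is_derive_tensor p x i :
  is_derive x (delta_mx ord0 i) (tensor p) (tensor (tensor_deriv i p) x).
Proof.
apply: is_derive_of_slice.
set K := \prod_(j | j != i) (p j).[x ord0 j].
rewrite (_ : (fun s => _) = (fun s => (p i).[s]) * cst K); last first.
  by apply/funext => s; exact: tensor_replace.
apply: is_derive_eq.
rewrite scaler0 add0r /tensor (bigD1 i)//= /tensor_deriv eqxx.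
rewrite mulr1 [LHS]mulrC; congr (_ * _).
by apply: eq_bigr => j /negbTE ->.
Qed.

Lemma partial_tensor p i : partial i (tensor p) = tensor (tensor_deriv i p).
Proof.
by apply/funext => x; have [_ <-] := is_derive_tensor p x i.
Qed.

Lemma partials_tensor s p :
  partials s (tensor p) = tensor (foldr tensor_deriv p s).
Proof. by elim: s => //= i s; rewrite /partials => ->; exact: partial_tensor. Qed.

Lemma Ck_on_tensor U k p : Ck_on U k (tensor p).
Proof.
move=> s _ x _; rewrite partials_tensor; split; first exact: continuous_tensor.
by move=> _ i; have [] := is_derive_tensor (foldr tensor_deriv p s) x i.
Qed.

Lemma smooth_closure_tensor a b p : smooth_closure a b (tensor p).
Proof.
exists setT, (tensor p); split => //; first exact: openT.
by move=> k; exact: Ck_on_tensor.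
Qed.

Lemma Ck_closure_tensor a b k p : Ck_closure a b k (tensor p).
Proof.
split=> [||s _]; [|exact: Ck_on_tensor|].
  by apply: continuous_subspaceT; exact: continuous_tensor.
exists (tensor (foldr tensor_deriv p s)); split.
  by apply: continuous_subspaceT; exact: continuous_tensor.
by move=> x _; rewrite partials_tensor.
Qed.

End tensor_polynomials.

(** * Integration by parts against test functions *)

Section integration_by_parts.
Context {R : realType} {d : nat} (a b : 'rV[R]_d).
Hypothesis hab : forall i, a ord0 i < b ord0 i.
Implicit Types (x : 'rV[R]_d) (p : 'I_d -> {poly R}) (i : 'I_d).
Let hab' i : a ord0 i <= b ord0 i. Proof. exact/ltW/hab. Qed.

(** On a slice in direction i the integral of the derivative is a difference of values
    of u at points of two opposite faces, where u vanishes. *)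
Lemma integral_box_partial0 (u : 'rV[R]_d -> R) i :
  (forall x, derivable u x (delta_mx ord0 i)) -> continuous (partial i u) ->
  (forall x, ~ (box a b)° x -> u x = 0) ->
  integral_box a b (partial i u) = 0%E.
Proof.
move=> du cu u0; rewrite /integral_box integral_mkcond.
apply: (integral_rV_slices0 (i := i)).
  apply/(integrable_mkcond _ (@measurable_box _ _ a b)).
  exact: integrable_continuous_box.
move=> x.
have [xab|xab] := pselect (forall j, j != i -> a ord0 j <= x ord0 j <= b ord0 j).
  have boxE t : box a b (replace_coord x i t) <-> `[a ord0 i, b ord0 i]%classic t.
    rewrite /= in_itv/=; split=> [/(_ i)|tab j]; first by rewrite mxE eqxx.
    by rewrite mxE; case: eqP => [->//|/eqP/xab].
  have face t : t = a ord0 i \/ t = b ord0 i -> u (replace_coord x i t) = 0.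
    move=> tab; apply: u0; rewrite interior_box => /(_ i) /=.
    by rewrite mxE eqxx in_itv/=; case: tab => ->; rewrite ltxx ?andbF.
  have dslice t := is_derive_slice (du (replace_coord x i t)).
  rewrite (_ : (fun t => _) =
      (EFin \o (fun t => partial i u (replace_coord x i t)))
        \_ `[a ord0 i, b ord0 i]).
    rewrite -integral_mkcond.
    rewrite (@continuous_FTC2 _ _ (fun t => u (replace_coord x i t)))//.
    - by rewrite (face _ (or_introl erefl)) (face _ (or_intror erefl)) subee.
    - apply: continuous_subspaceT => t.
      apply: (@continuous_comp _ _ _ (replace_coord x i) (partial i u)).
        exact: continuous_replace_coord.
      exact: cu.
    - have cs t : {for t, continuous (fun t => u (replace_coord x i t))}.
        apply: differentiable_continuous; apply/derivable1_diffP.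
        by have [] := dslice t.
      split; [by move=> t _; have [] := dslice t| |].
      + exact/cvg_at_right_filter/cs.
      + exact/cvg_at_left_filter/cs.
    - by move=> t _; rewrite derive1E; have [] := dslice t.
  apply/funext => t; rewrite !patchE; case: ifPn => [|] tb; case: ifPn => // tc.
    by move: tb tc; rewrite inE notin_setE => /boxE ? /(_ _).
  by move: tb tc; rewrite inE notin_setE => nb /boxE.
apply: integral0_eq => t _; rewrite patchE memNset// => bx.
by apply: xab => j /negbTE ji; have := bx j; rewrite mxE ji.
Qed.

Lemma integral_box_fin (f : 'rV[R]_d -> R) : continuous f ->
  integral_box a b f \is a fin_num.
Proof.
move=> cf; apply: integrable_fin_num; first exact: measurable_box.
exact: integrable_continuous_box.
Qed.

Lemma tensor_integration_by_parts p i psi :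
  test_function (box a b)° psi ->
  integral_box a b (fun x => tensor p x * partial i psi x) =
  (- integral_box a b (fun x => tensor (tensor_deriv i p) x * psi x)%R)%E.
Proof.
move=> [spsi [K [cK Ksub psi0]]].
have cpsi : continuous psi by move=> x; have [] := spsi 1%N [::] isT x Logic.I.
have dpsi x : derivable psi x (delta_mx ord0 i).
  by have [_] := spsi 1%N [::] isT x Logic.I; exact.
have cdpsi : continuous (partial i psi).
  by move=> x; have [] := spsi 1%N [:: i] isT x Logic.I.
have dp x : derivable (tensor p) x (delta_mx ord0 i).
  by have [] := is_derive_tensor p x i.
(* u vanishes outside the support of psi, hence off the interior of the box. *)
pose u := tensor p * psi.
have du x : derivable u x (delta_mx ord0 i) by exact: derivableM.
have uE : partial i u = (fun x => tensor p x * partial i psi x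
    + tensor (tensor_deriv i p) x * psi x).
  apply/funext => x; rewrite /partial deriveM// -/(partial i psi x).
  by rewrite -/(partial i (tensor p) x) partial_tensor [_ *: _ in X in _ + X]mulrC.
have c1 : continuous (fun x => tensor p x * partial i psi x).
  by move=> x; apply: continuousM; [exact: continuous_tensor|exact: cdpsi].
have c2 : continuous (fun x => tensor (tensor_deriv i p) x * psi x).
  by move=> x; apply: continuousM; [exact: continuous_tensor|exact: cpsi].
have : integral_box a b (partial i u) = 0%E.
  apply: integral_box_partial0 => //.
    by rewrite uE => x; exact: (continuousD (c1 x) (c2 x)).
  by move=> x nx; rewrite /u /= fctE psi0 ?mulr0// => /Ksub.
rewrite uE /integral_box; under eq_integral do rewrite EFinD.
rewrite integralD//=; last 3 first.
- exact: measurable_box.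
- exact: integrable_continuous_box.
- exact: integrable_continuous_box.
have := integral_box_fin c1; have := integral_box_fin c2.
rewrite /integral_box => /fineK <- /fineK <-.
by rewrite -EFinD => -[] /eqP; rewrite addr_eq0 => /eqP ->; rewrite EFinN.
Qed.

End integration_by_parts.

(** * Distributional derivatives of products *)

Section density_measures.
Context d0 (T : measurableType d0) (R : realType).
Variables (nu : {finite_measure set T -> \bar R})
          (mu : {sigma_finite_measure set T -> \bar R}).

(** The density rho agrees almost everywhere with the Radon-Nikodym derivative, whose
    change of variables formula is then the claim. *)
Lemma integral_density (rho f : T -> \bar R) (E : set T) :
  mu.-integrable setT rho ->
  (forall A, measurable A -> nu A = \int[mu]_(x in A) rho x)%E ->
  measurable E -> nu.-integrable E f ->
  (\int[nu]_(x in E) f x = \int[mu]_(x in E) (f x * rho x))%E.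
Proof.
move=> intrho nuE mE intf.
have mrho := measurable_int _ intrho.
have numu : nu `<< mu.
  apply/null_content_dominatesP => A mA A0; rewrite [LHS]nuE//.
  by apply: null_set_integral => //; exact: measurable_funTS.
rewrite -(Radon_Nikodym_change_of_variables numu mE intf).
apply: ae_eq_integral => //.
- apply: emeasurable_funM; first exact: measurable_int intf.
  apply: measurable_funTS; apply: measurable_int; exact: Radon_Nikodym_integrable.
- apply: emeasurable_funM; first exact: measurable_int intf.
  exact: measurable_funTS.
apply: ae_eqe_mul2l.
apply: (@ae_eq_subset _ _ _ _ mu setT) => //.
apply: integral_ae_eq => //.
  exact: Radon_Nikodym_integrable.
move=> A _ mA; rewrite -nuE//.
by rewrite -[RHS]/(charge_of_finite_measure nu A) -Radon_Nikodym_integral.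
Qed.

End density_measures.

Section distributional_derivatives.
Context {R : realType} {d : nat} (a b : 'rV[R]_d).
Hypothesis hab : forall i, a ord0 i < b ord0 i.
Implicit Types (x : 'rV[R]_d) (p : 'I_d -> {poly R}) (i : 'I_d).
Let hab' i : a ord0 i <= b ord0 i. Proof. exact/ltW/hab. Qed.
Local Notation S := (box a b).

Lemma measurable_interior_box : measurable S°.
Proof.
rewrite interior_box.
apply: (@measurable_cylinder R d (fun i => `]a ord0 i, b ord0 i[%classic)) => i.
exact: measurable_itv.
Qed.

Lemma ae_lebesgue_box n (lo hi : 'rV[R]_n) (P : 'rV[R]_n -> Prop) :
  (forall y, box lo hi y -> P y) -> {ae lebesgue_box lo hi, forall y, P y}.
Proof.
move=> boxP; exists (~` box lo hi); split.
- by apply: measurableC; exact: measurable_box.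
- by rewrite /lebesgue_box /mrestr /= setICl measure0.
- by move=> y /= nP /boxP.
Qed.

Lemma in_Linf_continuous (f : 'rV[R]_d -> R) : continuous f -> in_Linf a b f.
Proof.
move=> cf; split; first exact: measurable_funTS (continuous_measurable_rV cf).
have [M fM] := bounded_continuous_box a b cf.
apply: (@le_lt_trans _ _ M%:E); last exact: ltry.
apply/ess_supP.
apply: (@ae_lebesgue_box _ a b (fun x => `|f x|%:E <= M%:E)%E) => x /fM.
by rewrite lee_fin.
Qed.

Lemma in_W1inf_tensor p : in_W1inf a b (tensor p).
Proof.
split; first by apply: in_Linf_continuous; exact: continuous_tensor.
move=> i; exists (tensor (tensor_deriv i p)); split.
  by apply: in_Linf_continuous; exact: continuous_tensor.
by move=> psi /tensor_integration_by_parts; exact.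
Qed.

(** When the classical derivative is nonnegative on S, the measure with that density
    on S is the distributional derivative.  It is positive, so the Hahn decomposition
    is trivial and the total variation is the mass. *)
Lemma exists_distr_partial_tensor p i :
  (forall x, S x -> 0 <= tensor (tensor_deriv i p) x) ->
  exists nu P N (nuPN : hahn_decomposition nu P N),
    distr_partial a b i (tensor p) nuPN /\
    (charge_variation nuPN S° <= integral_box a b (tensor (tensor_deriv i p)))%E.
Proof.
move=> g0; set g := tensor (tensor_deriv i p) in g0 *.
have cg : continuous g by exact: continuous_tensor.
pose rho := (EFin \o g) \_ S.
have mS : measurable S by exact: measurable_box.
have rho0 x : (0 <= rho x)%E.
  by rewrite /rho patchE; case: ifPn => //; rewrite inE => /g0; rewrite lee_fin.
have irho : (lebesgue_rV d).-integrable setT rho.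
  apply/(integrable_mkcond _ mS).
  exact: integrable_continuous_box.
pose nu : {charge set 'rV[R]_d -> \bar R} := induced_charge irho.
have nu0 A : (0 <= nu A)%E by apply: integral_ge0.
have nuPN : hahn_decomposition nu setT set0.
  split; [split=> //|split=> //| |].
  - by move=> A _; rewrite subset0 => ->; rewrite charge0.
  - by rewrite setU0.
  - by rewrite setI0.
have posE A : measurable A ->
    jordan_pos nuPN A = (\int[lebesgue_rV d]_(x in A) rho x)%E.
  move=> mA; rewrite jordan_posE cjordan_posE /crestr0 mem_set//=.
  by rewrite /crestr setIT.
have negE A : measurable A -> jordan_neg nuPN A = 0%E.
  move=> mA; rewrite jordan_negE cjordan_negE /crestr0 mem_set//=.
  by rewrite /crestr setI0 charge0 oppe0.
have mSo := measurable_interior_box.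
have SoS : S° `<=` S by exact: interior_subset.
have rhoE x : S° x -> rho x = (g x)%:E.
  by move=> /SoS Sx; rewrite /rho patchE mem_set.
exists nu, setT, set0, nuPN; split.
  move=> psi psiP; rewrite tensor_integration_by_parts//; congr (- _)%E.
  have [spsi [K [_ KS psi0]]] := psiP.
  have cpsi : continuous psi by move=> x; have [] := spsi 1%N [::] isT x Logic.I.
  rewrite /charge_integral (@eq_measure_integral _ _ _ S° mzero (jordan_neg nuPN)).
    rewrite integral_measure_zero sube0 (integral_density irho)//; last first.
      apply: measurable_bounded_integrable => //.
      - by rewrite -ge0_fin_numE//; exact: fin_num_measure.
      - exact: measurable_funTS (continuous_measurable_rV cpsi).
      have [M fM] := bounded_continuous_box a b cpsi.
      exists M; split; first exact: num_real.
      by move=> N MN x /SoS Sx; apply: le_trans (fM _ Sx) (ltW MN).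
    rewrite /integral_box integral_mkcond [RHS]integral_mkcond.
    apply: eq_integral => x _; rewrite !patchE.
    have [Sx|nSx] := pselect (S° x).
      rewrite (mem_set Sx) mem_set; last exact: SoS.
      by rewrite rhoE// -EFinM mulrC.
    by rewrite (memNset nSx) [psi x]psi0 ?mulr0 ?if_same// => /KS.
  by move=> A mA _; exact: negE.
rewrite /charge_variation /= posE// negE// adde0 /integral_box.
under eq_integral => x /[!inE] Sx do rewrite rhoE//.
apply: ge0_subset_integral => //.
apply/measurable_EFinP; exact: measurable_funTS (continuous_measurable_rV cg).
Qed.

End distributional_derivatives.

(** * The functionals on products *)

Section tensor_functionals.
Context {R : realType} {d : nat} (a b : 'rV[R]_d).
Hypothesis hab : forall i, a ord0 i < b ord0 i.
Implicit Types (x : 'rV[R]_d) (p q : 'I_d -> {poly R}) (i : 'I_d) (I : {set 'I_d}).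
Let hab' i : a ord0 i <= b ord0 i. Proof. exact/ltW/hab. Qed.
Local Notation S := (box a b).
Local Notation itv i := `[a ord0 i, b ord0 i]%classic.
Local Notation "'Int_ i g" := (\int[lebesgue_measure]_(t in itv i) g t)
  (at level 10, i at level 2, g at level 9).

Lemma integral_box_prod (g : 'I_d -> R -> R) :
  (forall i, lebesgue_measure.-integrable (itv i) (EFin \o g i)) ->
  integral_box a b (fun x => \prod_i g i (x ord0 i)) = (\prod_i 'Int_i (g i))%:E.
Proof.
move=> intg; rewrite /integral_box box_cylinder.
apply: (integral_prod_cylinder (A := fun i => itv i) _ intg).2 => i.
exact: measurable_itv.
Qed.

Lemma integral_box_tensor p :
  integral_box a b (tensor p) = (\prod_i 'Int_i (horner (p i)))%:E.
Proof. by apply: integral_box_prod => i; exact: integrable_horner. Qed.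

Lemma integrable_norm_horner (l u : R) (r : {poly R}) :
  lebesgue_measure.-integrable `[l, u] (EFin \o (fun t => `|r.[t]|)).
Proof. exact: integrable_norm (integrable_horner _ _ _). Qed.

Lemma L1_norm_tensor p :
  L1_norm a b (tensor p) = (\prod_i 'Int_i (fun t => `|(p i).[t]|))%:E.
Proof.
rewrite -integral_box_prod; last by move=> i; exact: integrable_norm_horner.
by congr (integral_box a b); apply/funext => x; rewrite /tensor normr_prod.
Qed.

Lemma centered_tensor I q : (forall i, i \in I -> 'Int_i (horner (q i)) = 0) ->
  centered a b I (tensor q).
Proof.
move=> q0 i iI; apply: aeW => x; rewrite /Pi_.
under eq_Rintegral do rewrite tensor_replace.
by rewrite RintegralZr//; [rewrite q0// mul0r mulr0|exact: integrable_horner].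
Qed.

Lemma prob_density_tensor p :
  (forall i t, a ord0 i <= t <= b ord0 i -> 0 <= (p i).[t]) ->
  (forall i, 'Int_i (horner (p i)) = 1) -> prob_density a b (tensor p).
Proof.
move=> p0 p1; split.
- exact: measurable_funTS (continuous_measurable_rV (@continuous_tensor _ _ p)).
- by move=> x Sx; apply: prodr_ge0 => i _; exact: p0.
by rewrite integral_box_tensor big1.
Qed.

Lemma expectation_density_tensor p q :
  expectation_density a b (tensor p) (tensor q) =
  (\prod_i 'Int_i (horner (q i * p i)))%:E.
Proof.
rewrite -integral_box_tensor; congr (integral_box a b); apply/funext => x.
by rewrite /tensor -big_split; apply: eq_bigr => i _; rewrite hornerM.
Qed.

Lemma TV_dir_ge0 i (f : 'rV[R]_d -> R) : (0 <= TV_dir a b i f)%E.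
Proof.
apply: le_ereal_inf_tmp => _ [nu [P [N [nuPN [_ ->]]]]].
by rewrite adde_ge0//; exact: measure_ge0.
Qed.

(** The derivative is a product of nonnegative factors; the factor (p i)' integrates to
    the increase of p i along the side. *)
Lemma TV_dir_tensor_le p i :
  (forall j t, a ord0 j <= t <= b ord0 j -> 0 <= (p j).[t]) ->
  (forall t, a ord0 i <= t <= b ord0 i -> 0 <= (p i)^`().[t]) ->
  (TV_dir a b i (tensor p) <=
   (((p i).[b ord0 i] - (p i).[a ord0 i]) *
     \prod_(j | j != i) 'Int_j (horner (p j)))%:E)%E.
Proof.
move=> p0 p'0.
have d0 x : S x -> 0 <= tensor (tensor_deriv i p) x.
  move=> Sx; apply: prodr_ge0 => j _; rewrite /tensor_deriv.
  by case: eqP => [->|_]; [apply: p'0|apply: p0]; exact: Sx.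
have [nu [P [N [nuPN [nuD nuV]]]]] := exists_distr_partial_tensor hab d0.
apply: (@le_trans _ _ (charge_variation nuPN S°)).
  by apply: ereal_inf_lbound; exists nu, P, N, nuPN.
apply: le_trans nuV _; rewrite integral_box_tensor (bigD1 i)//=.
rewrite {1}/tensor_deriv eqxx Rintegral_deriv_horner// lee_fin.
rewrite le_eqVlt; apply/orP; left; apply/eqP; congr (_ * _).
by apply: eq_bigr => j /negbTE ji; rewrite /tensor_deriv ji.
Qed.

Lemma in_BV_tensor p :
  (forall i x, S x -> 0 <= tensor (tensor_deriv i p) x) -> in_BV a b (tensor p).
Proof.
move=> d0; split.
  by apply: integrable_continuous_box => //; exact: continuous_tensor.
move=> i; have [nu [P [N [nuPN [nuD _]]]]] := exists_distr_partial_tensor hab (d0 i).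
by exists nu, P, N, nuPN.
Qed.

Lemma foldr_tensor_deriv p (s : seq 'I_d) : uniq s ->
  foldr tensor_deriv p s = fun i => if i \in s then (p i)^`() else p i.
Proof.
elim: s => [|i s ih] /=; first by move=> _; apply/funext.
move=> /andP[si us]; rewrite ih//; apply/funext => j.
rewrite /tensor_deriv in_cons; case: eqP => //= ->.
by rewrite (negbTE si).
Qed.

Lemma mixed_variation_tensor_le I p :
  (forall j t, a ord0 j <= t <= b ord0 j -> 0 <= (p j).[t]) ->
  (forall j t, j \in I -> a ord0 j <= t <= b ord0 j -> 0 <= (p j)^`().[t]) ->
  (mixed_variation a b I (tensor p) <=
   (\prod_(i in I) ((p i).[b ord0 i] - (p i).[a ord0 i]) *
     \prod_(i | i \notin I) 'Int_i (horner (p i)))%:E)%E.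
Proof.
move=> p0 p'0; rewrite /mixed_variation partials_tensor.
rewrite foldr_tensor_deriv ?enum_uniq//.
set r := fun i => _.
have r0 x : S x -> 0 <= tensor r x.
  move=> Sx; apply: prodr_ge0 => j _; rewrite /r mem_enum.
  by case: ifPn => [jI|_]; [apply: p'0|apply: p0] => //; exact: Sx.
have mr : measurable_fun S (fun x => `|tensor r x|%:E).
  apply/measurable_EFinP; apply: measurableT_comp => //.
  exact: measurable_funTS (continuous_measurable_rV (@continuous_tensor _ _ r)).
apply: (@le_trans _ _ (integral_box a b (tensor r))).
  apply: (@le_trans _ _ (\int[lebesgue_rV d]_(x in S) `|tensor r x|%:E)%E).
    apply: ge0_subset_integral => //.
    + exact: measurable_interior_box.
    + exact: measurable_box.
    + exact: interior_subset.
  rewrite le_eqVlt; apply/orP; left; apply/eqP/eq_integral => x /[!inE] Sx.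
  by rewrite ger0_norm// r0.
rewrite integral_box_tensor (bigID (mem I))/= lee_fin.
rewrite le_eqVlt; apply/orP; left; apply/eqP; congr (_ * _); apply: eq_bigr => i iI.
  by rewrite /r mem_enum iI Rintegral_deriv_horner.
by rewrite /r mem_enum (negbTE iI).
Qed.

End tensor_functionals.

(** * Envelopes *)

Section envelopes.
Context {R : realType} {d : nat} (a b : 'rV[R]_d).
Hypothesis hab : forall i, a ord0 i < b ord0 i.
Implicit Types (x : 'rV[R]_d) (p q : 'I_d -> {poly R}) (i : 'I_d) (I : {set 'I_d}).
Let hab' i : a ord0 i <= b ord0 i. Proof. exact/ltW/hab. Qed.
Local Notation S := (box a b).
Local Notation itv i := `[a ord0 i, b ord0 i]%classic.
Local Notation "'Int_ i g" := (\int[lebesgue_measure]_(t in itv i) g t)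
  (at level 10, i at level 2, g at level 9).

Lemma glue_in I (t : 'rV[R]_#|I|) (y : 'rV[R]_#|~: I|) j :
  Defs.glue t y ord0 (enum_val j) = t ord0 j.
Proof.
rewrite mxE !summxE (bigD1 j)//= big1 => [|l lj].
  rewrite big1 => [|l _]; first by rewrite !mxE !eqxx mulr1 !addr0.
  rewrite !mxE eqxx /=; case: eqP => [E|]; last by rewrite mulr0.
  by have := enum_valP l; rewrite -E inE enum_valP.
by rewrite !mxE eqxx/= (inj_eq enum_val_inj) eq_sym (negbTE lj) mulr0.
Qed.

Lemma glue_out I (t : 'rV[R]_#|I|) (y : 'rV[R]_#|~: I|) j :
  Defs.glue t y ord0 (enum_val j) = y ord0 j.
Proof.
rewrite mxE !summxE addrC (bigD1 j)//= big1 => [|l lj].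
  rewrite big1 => [|l _]; first by rewrite !mxE !eqxx mulr1 !addr0.
  rewrite !mxE eqxx /=; case: eqP => [E|]; last by rewrite mulr0.
  by have := enum_valP j; rewrite E inE enum_valP.
by rewrite !mxE eqxx/= (inj_eq enum_val_inj) eq_sym (negbTE lj) mulr0.
Qed.

(** A slice of the form used in the slice envelope is a slice obtained by replacing one
    coordinate, which is the form that factorizes. *)
Lemma glue_set1 i t (y : 'rV[R]_#|~: [set i]|) :
  Defs.glue (I := [set i]) (const_mx t) y =
  replace_coord (Defs.glue (I := [set i]) (const_mx 0) y) i t.
Proof.
apply/rowP => l; rewrite [RHS]mxE; case: eqP => [->|/eqP li].
  have ii : i \in [set i]%SET by rewrite inE.
  by rewrite -{3}(enum_rankK_in ii ii) glue_in mxE.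
have lI : l \in (~: [set i])%SET by rewrite !inE.
by rewrite -(enum_rankK_in lI lI) !glue_out.
Qed.

Lemma glue_box I (t : 'rV[R]_#|I|) (y : 'rV[R]_#|~: I|) l :
  box (subcoords (~: I) a) (subcoords (~: I) b) y -> l \notin I ->
  a ord0 l <= Defs.glue t y ord0 l <= b ord0 l.
Proof.
move=> ybox lI; have lI' : l \in (~: I)%SET by rewrite inE.
have -> : Defs.glue t y ord0 l = y ord0 (enum_rank_in lI' l).
  by rewrite -{1}(enum_rankK_in lI' lI') glue_out.
by have := ybox (enum_rank_in lI' l); rewrite !mxE enum_rankK_in.
Qed.

Lemma Lambda_sl_tensor_le I q (M : R) :
  (forall j t, a ord0 j <= t <= b ord0 j -> `|(q j).[t]| <= 1) ->
  (forall i, i \in I -> 'Int_i (fun t => `|(q i).[t]|) <= M) ->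
  (Lambda_sl a b I (tensor q) <= M%:E)%E.
Proof.
move=> q1 qM; apply: bigmax_le; first exact: leNye.
move=> i iI; apply/ess_supP.
apply: (@ae_lebesgue_box _ _ _ _ (fun y =>
  (\int[lebesgue_measure]_(t in itv i)
    `|tensor q (Defs.glue (I := [set i]) (const_mx t) y)|%:E <= M%:E)%E)) => y ybox.
have li l : l != i -> l \notin [set i]%SET by rewrite inE.
apply: (@le_trans _ _ (\int[lebesgue_measure]_(t in itv i) `|(q i).[t]|%:E)%E).
  apply: ge0_le_integral => //=.
  - rewrite (_ : (fun t => _) = (fun t => (`|(q i).[t]|%:E *
        `|\prod_(j | j != i)
            (q j).[Defs.glue (I := [set i]) (const_mx 0) y ord0 j]|%:E)%E)).
      apply: emeasurable_funM => //.
      exact: measurable_int (integrable_norm_horner _ _ _).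
    by apply/funext => t; rewrite glue_set1 tensor_replace normrM EFinM.
  - exact: measurable_int (integrable_norm_horner _ _ _).
  - move=> t _; rewrite glue_set1 tensor_replace normrM lee_fin ler_piMr//.
    rewrite normr_prod; apply: prodr_ile1 => l /li lI; rewrite normr_ge0 /=.
    by apply: q1; exact: glue_box.
have := qM _ iI; rewrite -lee_fin /Rintegral fineK//.
apply: integrable_fin_num => //; exact: integrable_norm_horner.
Qed.

Lemma Lambda_mix_tensor_le I q : (forall j, j \notin I -> q j = 1) ->
  (Lambda_mix a b I (tensor q) <=
    (\prod_(i in I) 'Int_i (fun t => `|(q i).[t]|))%:E)%E.
Proof.
move=> q1; apply/ess_supP.
apply: (@ae_lebesgue_box _ _ _ _ (fun y =>
  (\int[lebesgue_rV #|I|]_(t in box (subcoords I a) (subcoords I b))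
    `|tensor q (Defs.glue t y)|%:E <= _)%E)) => y _.
rewrite le_eqVlt; apply/orP; left; apply/eqP.
rewrite big_enum_val -[LHS]/(integral_box (subcoords I a) (subcoords I b)
  (fun t => `|tensor q (Defs.glue t y)|)).
rewrite (_ : (fun t => `|tensor q (Defs.glue t y)|) =
  (fun t : 'rV[R]_#|I| =>
    \prod_j (fun j s => `|(q (enum_val j)).[s]|) j (t ord0 j))); last first.
  apply/funext => t; rewrite /tensor normr_prod (bigID (mem I))/=.
  rewrite [X in _ * X]big1 ?mulr1; last by move=> l lI; rewrite q1// hornerC normr1.
  by rewrite big_enum_val; apply: eq_bigr => j _; rewrite glue_in.
apply: (etrans (integral_box_prod
  (g := fun j s => `|(q (enum_val j)).[s]|) _)) => [j|].
  exact: integrable_norm_horner.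
by congr EFin; apply: eq_bigr => j _; rewrite !mxE.
Qed.

Lemma lebesgue_box_gt0 n (lo hi : 'rV[R]_n) :
  (forall j, lo ord0 j < hi ord0 j) -> (0 < lebesgue_box lo hi setT)%E.
Proof.
move=> lohi; rewrite /lebesgue_box /mrestr setTI.
rewrite lebesgue_rV_box => [|j]; last exact/ltW.
by rewrite lte_fin; apply: prodr_gt0 => j _; rewrite subr_gt0.
Qed.

Lemma subcoords_lt I j : (subcoords I a) ord0 j < (subcoords I b) ord0 j.
Proof. by rewrite !mxE. Qed.

(** An essential supremum over a null space would be -oo; the faces of S have positive
    measure. *)
Lemma Lambda_sl_ge0 I (phi : 'rV[R]_d -> R) : I != finset.set0 ->
  (0 <= Lambda_sl a b I phi)%E.
Proof.
move=> /finset.set0Pn[i iI]; apply: (bigmax_sup i) => //.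
apply: ess_sup_gee; first by apply: lebesgue_box_gt0 => j; exact: subcoords_lt.
by apply: aeW => y; exact: integral_ge0.
Qed.

Lemma Lambda_mix_ge0 I (phi : 'rV[R]_d -> R) : (0 <= Lambda_mix a b I phi)%E.
Proof.
apply: ess_sup_gee; first by apply: lebesgue_box_gt0 => j; exact: subcoords_lt.
by apply: aeW => y; exact: integral_ge0.
Qed.

End envelopes.

(** * Vitali variation *)

Section vitali.
Context {R : realType} {d : nat} (a b : 'rV[R]_d).
Hypothesis hab : forall i, a ord0 i < b ord0 i.
Implicit Types (x : 'rV[R]_d) (p q : 'I_d -> {poly R}) (i : 'I_d).
Let hab' i : a ord0 i <= b ord0 i. Proof. exact/ltW/hab. Qed.
Local Notation S := (box a b).

(** Expanding the product of the differences over the two endpoints of each side gives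
    the alternating sum over the vertices. *)
Lemma vertex_sum_tensor p (lo hi : 'rV[R]_d) :
  vertex_sum (tensor p) lo hi =
  \prod_i ((p i).[hi ord0 i] - (p i).[lo ord0 i]).
Proof.
pose F i (c : bool) := (-1) ^+ c *
  (p i).[hi ord0 i + c%:R * (lo ord0 i - hi ord0 i)].
transitivity (\prod_i \sum_(c : bool) F i c); last first.
  apply: eq_bigr => i _; rewrite big_bool /F /= expr0 expr1 mul1r mul0r addr0.
  by rewrite mul1r addrC mulN1r; congr (_ - (p i).[_]); ring.
rewrite bigA_distr_bigA; apply: eq_bigr => nu _; rewrite big_split /= prodrXr.
by congr (_ * _); apply: eq_bigr => i _; rewrite mxE.
Qed.

Lemma integral_interior_box_deriv p (lo hi : 'rV[R]_d) :
  (forall i, lo ord0 i < hi ord0 i) ->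
  (\int[lebesgue_rV d]_(x in (box lo hi)°) (\prod_i (p i)^`().[x ord0 i])%:E =
   (\prod_i ((p i).[hi ord0 i] - (p i).[lo ord0 i]))%:E)%E.
Proof.
move=> lohi; rewrite interior_box.
apply: (etrans (integral_prod_cylinder (A := fun i => `]lo ord0 i, hi ord0 i[%classic)
  (g := fun i => horner (p i)^`()) _ _).2) => [i|i|].
- exact: measurable_itv.
- apply: integrableS (integrable_horner (lo ord0 i) (hi ord0 i) _) => //.
  exact: subset_itv_oo_cc.
congr EFin; apply: eq_bigr => i _.
rewrite -Rintegral_deriv_horner// /Rintegral; congr fine.
rewrite [RHS]integral_itv_bndoo//.
apply: measurable_funS (measurable_int _
  (integrable_horner (lo ord0 i) (hi ord0 i) _)) => //.
exact: subset_itv_oo_cc.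
Qed.

(** For nondecreasing factors the vertex sum over a box is the integral of the mixed
    derivative over its interior.  The interiors are disjoint subsets of the interior
    of S, so the total is at most the vertex sum over S. *)
Lemma vitali_variation_tensor_le p :
  (forall j t, a ord0 j <= t <= b ord0 j -> 0 <= (p j)^`().[t]) ->
  (vitali_variation a b (tensor p) <=
    (\prod_i ((p i).[b ord0 i] - (p i).[a ord0 i]))%:E)%E.
Proof.
move=> p'0; apply: ge_ereal_sup => _ [Q [Qlt Qdisj QS] <-].
set g := fun x : 'rV[R]_d => (\prod_i (p i)^`().[x ord0 i])%:E.
pose B j := (box (nth (0, 0) Q j).1 (nth (0, 0) Q j).2)°.
have sub j : (j < size Q)%N -> box (nth (0, 0) Q j).1 (nth (0, 0) Q j).2 `<=` S.
  by move=> jQ; rewrite -QS => x Bx; exists j.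
have mB j : measurable (B j) by exact: measurable_interior_box.
have BS j : (j < size Q)%N -> B j `<=` S°.
  by move=> jQ; apply: interiorS; exact: sub.
have mg : measurable_fun setT g.
  have := continuous_measurable_rV (@continuous_tensor _ _ (fun i => (p i)^`())).
  by move=> ?; exact/measurable_EFinP.
have g0 x : S x -> (0 <= g x)%E.
  by move=> Sx; rewrite lee_fin; apply: prodr_ge0 => i _; apply: p'0; exact: Sx.
have lohi j : (j < size Q)%N -> forall i,
    (nth (0, 0) Q j).1 ord0 i < (nth (0, 0) Q j).2 ord0 i.
  by move=> jQ; apply: Qlt; exact: mem_nth.
have -> : (\sum_(q <- Q) `|vertex_sum (tensor p) q.1 q.2|)%:E =
    (\sum_(j <- iota 0 (size Q)) \int[lebesgue_rV d]_(x in B j) g x)%E.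
  rewrite (big_nth (0, 0)) -sumEFin /index_iota subn0.
  rewrite big_seq [RHS]big_seq; apply: eq_bigr => j; rewrite mem_iota /= add0n => jQ.
  rewrite [RHS]integral_interior_box_deriv; last exact: lohi.
  congr EFin; rewrite vertex_sum_tensor ger0_norm//.
  rewrite -lee_fin -integral_interior_box_deriv; last exact: lohi.
  by apply: integral_ge0 => x /interior_subset /(sub _ jQ)/g0.
rewrite -ge0_integral_bigsetU//.
- rewrite -(integral_interior_box_deriv p hab) -/g.
  apply: ge0_subset_integral => //.
  + exact: bigsetU_measurable.
  + exact: measurable_interior_box.
  + exact: measurable_funTS.
  + by move=> x /interior_subset/g0.
  + rewrite -bigcup_seq => x [j /= jQ].
    by rewrite mem_iota /= add0n in jQ; exact: BS.
- exact: iota_uniq.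
- apply/trivIsetP => j l /= jQ lQ /eqP jl.
  rewrite mem_iota /= add0n in jQ; rewrite mem_iota /= add0n in lQ.
  exact: Qdisj.
- exact: measurable_funTS.
rewrite -bigcup_seq => x [j /= jQ Bx].
rewrite mem_iota /= add0n in jQ.
by apply: g0; apply: (sub _ jQ); exact: interior_subset.
Qed.

Lemma vitali_variation_ge0 (f : 'rV[R]_d -> R) : (0 <= vitali_variation a b f)%E.
Proof.
apply: le_ereal_sup_tmp; exists (\sum_(q <- [:: (a, b)]) `|vertex_sum f q.1 q.2|)%:E.
  exists [:: (a, b)] => //; split.
  - by move=> q; rewrite inE => /eqP ->.
  - by move=> [|j] [|l].
  - apply/seteqP; split => [x [[|j]]//|x Sx]; exists 0%N => //.
by rewrite lee_fin; apply: sumr_ge0.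
Qed.

End vitali.

(** * Nearly optimal pairs *)

Section extremal_pairs.
Context {R : realType} {d : nat} (a b : 'rV[R]_d).
Hypothesis hab : forall i, a ord0 i < b ord0 i.
Implicit Types (p q : 'I_d -> {poly R}) (I : {set 'I_d}).
Local Notation itv i := `[a ord0 i, b ord0 i]%classic.
Local Notation "'Int_ i g" := (\int[lebesgue_measure]_(t in itv i) g t)
  (at level 10, i at level 2, g at level 9).

Lemma Rintegral_itv_cst i (k : R) :
  'Int_i (cst k) = k * (b ord0 i - a ord0 i).
Proof.
rewrite Rintegral_cst//=; congr (_ * _).
have -> : fine (lebesgue_measure (itv i : set R)) = b ord0 i - a ord0 i; last by [].
by rewrite lebesgue_measure_itv/= lte_fin hab -EFinD.
Qed.

Lemma exists_lt_expr (x : R) n : x < 1 -> exists2 c : R, 0 < c < 1 & x < c ^+ n.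
Proof.
move=> x1; pose y := Num.max x 0; have y1 : y < 1 by rewrite gt_max x1 ltr01.
have y0 : 0 <= y by rewrite le_max lexx orbT.
have xy : x <= y by rewrite le_max lexx.
pose e := (1 - y) / n.+2%:R.
have e0 : 0 < e by rewrite divr_gt0 ?subr_gt0.
have e1 : e < 1.
  by rewrite ltr_pdivrMr// mul1r (@le_lt_trans _ _ 1)// ?ltr1n// lerBlDr lerDl.
exists (1 - e); first by rewrite subr_gt0 e1 gtrBl.
apply: (@lt_le_trans _ _ (1 - n%:R * e)).
  rewrite ltrBrDr -ltrBrDl mulrC /e mulrAC -mulrA.
  apply: (@lt_le_trans _ _ (1 - y)); last by rewrite lerD2l lerN2.
  by rewrite gtr_pMr ?subr_gt0// ltr_pdivrMr// mul1r ltr_nat.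
elim: n {e e0 e1 y y1 y0 xy} (e) (e0) (e1) => [|n ih] e e0 e1.
  by rewrite mul0r subr0 expr0.
rewrite exprS; apply: (@le_trans _ _ ((1 - e) * (1 - n%:R * e))).
  rewrite -natr1; have : 0 <= n%:R * e * e by rewrite !mulr_ge0// ltW.
  lra.
by apply: ler_wpM2l; [lra|exact: ih].
Qed.

Lemma exists_common_width : exists2 w : R, 0 < w &
  forall i, w <= (b ord0 i - a ord0 i) / 2.
Proof.
exists (\big[Num.min/1]_i ((b ord0 i - a ord0 i) / 2)).
  by apply: lt_bigmin => [|i _]; [exact: ltr01|]; rewrite divr_gt0// subr_gt0.
by move=> i; exact: bigmin_le_cond.
Qed.

(** The factors p of the density and q of the residual.  Outside I the density factor
    is constant and q is 1, so that these coordinates contribute neither to the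
    variations nor to the envelopes. *)
Lemma exists_extremal_factors I (c : R) : 0 < c < 1 ->
  exists (w : R) p q, 0 < w /\
  [/\ forall j t, a ord0 j <= t <= b ord0 j ->
        [/\ 0 <= (p j).[t], 0 <= (p j)^`().[t] & `|(q j).[t]| <= 1],
      forall j, 'Int_j (horner (p j)) = 1,
      forall j, j \in I -> [/\ 'Int_j (horner (q j)) = 0,
        'Int_j (fun t => `|(q j).[t]|) <= 2 * w / c,
        (p j).[b ord0 j] - (p j).[a ord0 j] <= (c * w)^-1 &
        c <= 'Int_j (horner (q j * p j))] &
      forall j, j \notin I ->
        q j = 1 /\ (p j).[b ord0 j] - (p j).[a ord0 j] = 0].
Proof.
move=> c01; have /andP[c0 c1] := c01.
have [w w0 wab] := exists_common_width.
have /choice[Gh GhP] : forall i, exists Gh : {poly R} * {poly R},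
  [/\ forall x, a ord0 i <= x <= b ord0 i ->
        [/\ 0 <= Gh.1.[x], 0 <= Gh.1^`().[x] & `|Gh.2.[x]| <= 1],
      'Int_i (horner Gh.2) = 0 /\ 'Int_i (horner Gh.1) = 1,
      c * 'Int_i (fun t => `|Gh.2.[t]|) <= 2 * w,
      c * w * (Gh.1.[b ord0 i] - Gh.1.[a ord0 i]) <= 1 &
      c <= 'Int_i (horner (Gh.2 * Gh.1))].
  move=> i; have [G [h Gh]] := exists_step_pair w0 (wab i) c01.
  by exists (G, h).
have L0 i : 0 < b ord0 i - a ord0 i by rewrite subr_gt0.
exists w, (fun i => if i \in I then (Gh i).1 else ((b ord0 i - a ord0 i)^-1)%:P),
  (fun i => if i \in I then (Gh i).2 else 1); split=> //; split.
- move=> j t tj; have [/(_ _ tj) ? _ _ _ _] := GhP j; case: ifP => // _.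
  by rewrite derivC !hornerE normr1 invr_ge0 ltW.
- move=> j; have [_ [_ ?] _ _ _] := GhP j; case: ifP => // _.
  under eq_Rintegral do rewrite hornerC.
  by rewrite Rintegral_itv_cst mulVf// gt_eqF.
- move=> j jI; rewrite jI; have [_ [? _] ? ? ?] := GhP j; split => //.
  + by rewrite ler_pdivlMr// mulrC.
  + by rewrite -[leRHS]mul1r ler_pdivlMr ?mulr_gt0// mulrC.
- by move=> j /negbTE ->; rewrite !hornerC subrr.
Qed.

Lemma TV_tensor_le p I (M : R) :
  (forall j t, a ord0 j <= t <= b ord0 j -> 0 <= (p j).[t] /\ 0 <= (p j)^`().[t]) ->
  (forall j, 'Int_j (horner (p j)) = 1) ->
  (forall j, j \in I -> (p j).[b ord0 j] - (p j).[a ord0 j] <= M) ->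
  (TV a b I (tensor p) <= (#|I|%:R * M)%:E)%E.
Proof.
move=> p0 p1 pI.
rewrite mulr_natl -sumr_const -sumEFin; apply: lee_sum => i iI.
apply: le_trans (TV_dir_tensor_le hab _ _) _.
- by move=> j t /p0[].
- by move=> t /p0[].
by rewrite big1 ?mulr1 ?lee_fin ?pI.
Qed.

Lemma TV_all_tensor_le p I :
  (forall j t, a ord0 j <= t <= b ord0 j -> 0 <= (p j).[t] /\ 0 <= (p j)^`().[t]) ->
  (forall j, j \notin I -> (p j).[b ord0 j] - (p j).[a ord0 j] = 0) ->
  (TV_all a b (tensor p) <= TV a b I (tensor p))%E.
Proof.
move=> p0 pI; rewrite /TV_all (bigID (mem I))/= -[leRHS]adde0 leeD2l//.
apply: sume_le0 => i iI.
apply: le_trans (TV_dir_tensor_le hab _ _) _.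
- by move=> j t /p0[].
- by move=> t /p0[].
by rewrite pI// mul0r.
Qed.

(** A negative C is replaced by a nonnegative C': the product of the two functionals is
    nonnegative, so this only makes the bound stronger. *)
Lemma mul_lt_of_bounds (C C' A B e : R) (Lam V : \bar R) :
  C <= C' -> 0 <= C' -> (0 <= Lam <= A%:E)%E -> (0 <= V <= B%:E)%E ->
  C' * A * B < e -> (C%:E * Lam * V < `|e%:E|)%E.
Proof.
move=> CC' C'0; case: Lam => [l| |]; rewrite ?leye_eq ?andbF//.
case: V => [v| |]; rewrite ?leye_eq ?andbF// !lee_fin.
move=> /andP[l0 lA] /andP[v0 vB] CAB.
rewrite -!EFinM lte_fin; apply: lt_le_trans (ler_norm _).
apply: le_lt_trans CAB; apply: (@le_trans _ _ (C' * l * v)).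
  by rewrite -!mulrA; apply: ler_wpM2r => //; rewrite mulr_ge0.
by rewrite !ler_pM// ?mulr_ge0// ler_wpM2l.
Qed.

Lemma Pi_cst i (k : R) : Pi_ a b i (cst k) = cst k.
Proof.
apply/funext => x; rewrite /Pi_ (Rintegral_itv_cst i k).
by rewrite mulrCA mulVf ?mulr1// gt_eqF// subr_gt0.
Qed.

(** In the limit c -> 1 the bounds are E_f[phi] >= 1, envelopes 2 w and (2 w)^k, and
    variations k / w and w^-k.  One pair serves for all of them, and w cancels in
    every product. *)
Lemma exists_near_optimal_pair I (c : R) : I != finset.set0 -> 0 < c < 1 ->
  exists (w e : R) (f phi : 'rV[R]_d -> R), 0 < w /\
  [/\ [/\ prob_density a b f, smooth_closure a b f, Ck_closure a b d f,
        in_W1inf a b phi & centered a b I phi],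
      [/\ expectation_density a b f phi = e%:E & c ^+ #|I| <= e],
      [/\ (0 <= Lambda_sl a b I phi <= (2 * w / c)%:E)%E,
        (0 <= TV a b I f <= (#|I|%:R * (c * w)^-1)%:E)%E &
        (0 <= TV_all a b f <= (#|I|%:R * (c * w)^-1)%:E)%E],
      [/\ (0 <= Lambda_mix a b I phi <= ((2 * w / c) ^+ #|I|)%:E)%E &
        (0 <= mixed_variation a b I f <= ((c * w)^-1 ^+ #|I|)%:E)%E] &
      I = finset.setTfor 'I_d ->
        (0 <= L1_norm a b phi <= ((2 * w / c) ^+ #|I|)%:E)%E /\
        (0 <= vitali_variation a b f <= ((c * w)^-1 ^+ #|I|)%:E)%E].
Proof.
move=> I0 c01; have /andP[c0 c1] := c01.
have [w [p [q [w0 [pq pint pqI pqN]]]]] := exists_extremal_factors I c01.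
have p0 j t : a ord0 j <= t <= b ord0 j -> 0 <= (p j).[t] by move=> /pq[].
have p'0 j t : a ord0 j <= t <= b ord0 j -> 0 <= (p j)^`().[t] by move=> /pq[].
have pp0 j t : a ord0 j <= t <= b ord0 j -> 0 <= (p j).[t] /\ 0 <= (p j)^`().[t].
  by move=> /pq[].
have q1 j t : a ord0 j <= t <= b ord0 j -> `|(q j).[t]| <= 1 by move=> /pq[].
have pI j : j \in I -> (p j).[b ord0 j] - (p j).[a ord0 j] <= (c * w)^-1.
  by move=> /pqI[].
have pN j : j \notin I -> (p j).[b ord0 j] - (p j).[a ord0 j] = 0.
  by move=> /pqN[].
have qabs j : j \in I -> 'Int_j (fun t => `|(q j).[t]|) <= 2 * w / c.
  by move=> /pqI[].
have dp0 j : 0 <= (p j).[b ord0 j] - (p j).[a ord0 j].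
  rewrite -Rintegral_deriv_horner//; apply: Rintegral_ge0 => t /=.
  by rewrite in_itv/=; exact: p'0.
have prodI (g : 'I_d -> R) (M : R) : (forall i, i \in I -> 0 <= g i <= M) ->
    \prod_(i in I) g i <= M ^+ #|I|.
  by move=> gM; rewrite -prodr_const; exact: ler_prod.
have mixq : \prod_(i in I) 'Int_i (fun t => `|(q i).[t]|) <= (2 * w / c) ^+ #|I|.
  by apply: prodI => i iI; rewrite qabs// andbT; exact: Rintegral_ge0.
have mixp : \prod_(i in I) ((p i).[b ord0 i] - (p i).[a ord0 i])
    <= (c * w)^-1 ^+ #|I|.
  by apply: prodI => i iI; rewrite pI// dp0.
have TV0 : (0 <= TV a b I (tensor p))%E.
  by apply: sume_ge0 => i _; exact: TV_dir_ge0.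
have TVle := TV_tensor_le pp0 pint pI.
exists w, (\prod_i 'Int_i (horner (q i * p i))), (tensor p), (tensor q).
split=> //; split.
- split; [exact: prob_density_tensor|exact: smooth_closure_tensor|
    exact: Ck_closure_tensor|exact: in_W1inf_tensor|].
  by apply: centered_tensor => i /pqI[].
- split; first exact: expectation_density_tensor.
  rewrite (bigID (mem I))/= [X in _ * X]big1 ?mulr1.
    by rewrite -prodr_const; apply: ler_prod => i /pqI[_ _ _ ?]; rewrite ltW.
  by move=> i /pqN[-> _]; rewrite mul1r.
- rewrite Lambda_sl_ge0// Lambda_sl_tensor_le// TV0 TVle; split=> //.
  rewrite (le_trans (TV_all_tensor_le pp0 pN) TVle) andbT.
  by apply: sume_ge0 => i _; exact: TV_dir_ge0.
- rewrite Lambda_mix_ge0//=; split.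
    apply: le_trans (Lambda_mix_tensor_le _ _ _) _ => [j /pqN[]//|].
    by rewrite lee_fin.
  rewrite integral_ge0//=; apply: le_trans (mixed_variation_tensor_le hab p0 _) _.
    by move=> j t _; exact: p'0.
  by rewrite [X in _ * X]big1 ?mulr1 ?lee_fin.
move=> IT; split.
  rewrite integral_ge0//= L1_norm_tensor lee_fin.
  by move: mixq; rewrite IT; under eq_bigl do rewrite finset.in_setT.
rewrite vitali_variation_ge0//=.
apply: le_trans (vitali_variation_tensor_le hab p'0) _.
by rewrite lee_fin; move: mixp; rewrite IT; under eq_bigl do rewrite finset.in_setT.
Qed.

Lemma calP_cst I (k : R) : I != finset.set0 -> calP a b I (cst k) = cst 0.
Proof.
move=> /finset.set0Pn[i iI]; rewrite /calP.
have : enum I != [::] by apply: contraTneq iI => eI; rewrite -mem_enum eI.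
elim: (enum I) => // j [|l s] ih _.
  by rewrite /= Pi_cst; apply/funext => x /=; rewrite subrr.
have -> : foldr (fun i g => g \- Pi_ a b i g) (cst k) [:: j, l & s] =
    cst 0 \- Pi_ a b j (cst 0) by rewrite -(ih isT).
by rewrite Pi_cst; apply/funext => x /=; rewrite subrr.
Qed.

Lemma envelopes_cst0 I : I != finset.set0 ->
  Lambda_sl a b I (cst 0) = 0%E /\ Lambda_mix a b I (cst 0) = 0%E.
Proof.
move=> I0; have /finset.set0Pn[i iI] := I0.
pose q j : {poly R} := if j \in I then 0 else 1.
have q0 j : j \in I -> q j = 0 by rewrite /q => ->.
have q1 j : j \notin I -> q j = 1 by rewrite /q => /negbTE ->.
have E : cst 0 = tensor q.
  by apply/funext => x; rewrite /tensor (bigD1 i)//= q0// hornerC mul0r.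
have Int0 j : j \in I -> 'Int_j (fun t => `|(q j).[t]|) = 0.
  move=> jI; under eq_Rintegral do rewrite q0// hornerC normr0.
  by rewrite /Rintegral integral0.
split; apply/eqP; rewrite eq_le ?Lambda_sl_ge0 ?Lambda_mix_ge0// andbT E.
  apply: Lambda_sl_tensor_le => [j t _|j jI]; last by rewrite Int0.
  by rewrite /q; case: ifP => _; rewrite hornerC ?normr0 ?normr1.
apply: le_trans (Lambda_mix_tensor_le a b q1) _.
by rewrite (bigD1 i)//= Int0// mul0r.
Qed.

End extremal_pairs.

Theorem theorem2p22 (R : realType) (d : nat) (hd : (1 <= d)%N)
    (a b : 'rV[R]_d) (hab : forall i : 'I_d, a ord0 i < b ord0 i)
    (I : {set 'I_d}) (hI : I != finset.set0) :
  (* (i) *)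
  ((forall C : R, C < (2 * #|I|%:R)^-1 ->
      exists f phi : 'rV[R]_d -> R,
        [/\ prob_density a b f, smooth_closure a b f,
            in_W1inf a b phi, centered a b I phi &
            (C%:E * Lambda_sl a b I phi * TV a b I f
               < `|expectation_density a b f phi|)%E]) /\
   (forall C : R, C < (2 * #|I|%:R)^-1 ->
      exists f phi : 'rV[R]_d -> R,
        [/\ prob_density a b f, smooth_closure a b f,
            in_W1inf a b phi, centered a b I phi &
            (C%:E * Lambda_sl a b I phi * TV_all a b f
               < `|expectation_density a b f phi|)%E])) /\
  (* (ii) *)
  (forall C : R, C < 2 ^- #|I| ->
     exists f phi : 'rV[R]_d -> R,
       [/\ prob_density a b f, smooth_closure a b f,
           in_W1inf a b phi, centered a b I phi &
           (C%:E * Lambda_mix a b I phi * mixed_variation a b I f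
              < `|expectation_density a b f phi|)%E]) /\
  (* (iii) *)
  (forall C : R, C < 2 ^- d ->
     exists f phi : 'rV[R]_d -> R,
       [/\ Ck_closure a b d f, in_Linf a b phi,
           centered a b (finset.setTfor 'I_d) phi &
           (C%:E * L1_norm a b phi * vitali_variation a b f
              < `|integral_box a b (fun x => (phi x * f x)%R)|)%E]) /\
  (* (iv) *)
  ((forall C : R, C < 1 ->
      exists f phi : 'rV[R]_d -> R,
        [/\ prob_density a b f, in_BV a b f, in_Linf a b phi &
            (((2 * #|I|%:R)^-1)%:E * Lambda_sl a b I (calP a b I phi)
                 * TV a b I f
               + C%:E * Linf_norm a b (calR a b I phi)
               < `|expectation_density a b f phi|)%E]) /\
   (forall C : R, C < 1 ->
      exists f phi : 'rV[R]_d -> R,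
        [/\ prob_density a b f, Ck_closure a b #|I| f, in_Linf a b phi &
            ((2 ^- #|I|)%:E * Lambda_mix a b I (calP a b I phi)
                 * mixed_variation a b I f
               + C%:E * Linf_norm a b (calR a b I phi)
               < `|expectation_density a b f phi|)%E])).
Proof.
have k0 : 0 < #|I|%:R :> R by rewrite ltr0n card_gt0.
(* C' D < 1 leaves room for a power of c; n counts the factors c lost in E_f[phi],
   in the envelope and in the variation. *)
have C'P C n (D : R) : 0 < D -> C < D^-1 -> exists C' c : R,
    [/\ C <= C', 0 <= C', 0 < c < 1 & C' * D < c ^+ n].
  move=> D0 CD; pose C' := Num.max C 0.
  have C'D : C' * D < 1.
    by rewrite -ltr_pdivlMr// mul1r gt_max CD invr_gt0.
  have [c c01 C'c] := exists_lt_expr n C'D.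
  by exists C', c; split=> //; rewrite le_max lexx ?orbT.
split.
  have numeric (C' c w : R) : 0 < c -> 0 < w ->
      C' * (2 * #|I|%:R) < c ^+ (#|I| + 2) ->
      C' * (2 * w / c) * (#|I|%:R * (c * w)^-1) < c ^+ #|I|.
    move=> c0 w0; rewrite exprD -ltr_pdivrMr ?exprn_gt0//; apply: le_lt_trans.
    by rewrite le_eqVlt; apply/orP; left; apply/eqP; field; rewrite !gt_eqF.
  have D0 : 0 < 2 * #|I|%:R :> R by rewrite mulr_gt0.
  split=> C /(C'P _ (#|I| + 2)%N _ D0)[C' [c [CC' C'0 c01 C'c]]];
    have [w [e [f [phi [w0 [[df sf _ wphi cphi] [E ce] [sl tv tvall] _ _]]]]]] :=
      exists_near_optimal_pair hab hI c01; exists f, phi; split => //;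
    rewrite E; have /andP[c0 _] := c01;
    have lt_e := lt_le_trans (numeric _ _ _ c0 w0 C'c) ce.
    exact: mul_lt_of_bounds CC' C'0 sl tv lt_e.
  exact: mul_lt_of_bounds CC' C'0 sl tvall lt_e.
have numeric (C' c w : R) n : 0 < c -> 0 < w -> C' * 2 ^+ n < c ^+ (3 * n) ->
    C' * (2 * w / c) ^+ n * (c * w)^-1 ^+ n < c ^+ n.
  move=> c0 w0; rewrite (_ : (3 * n = n + 2 * n)%N); last by lia.
  rewrite exprD -ltr_pdivrMr ?exprn_gt0//; apply: le_lt_trans.
  have E : 2 * w / c * (c * w)^-1 = 2 / c ^+ 2 by field; rewrite !gt_eqF.
  by rewrite -!mulrA -exprMn mulrA E exprMn exprVn -exprM.
split.
  move=> C /(C'P _ (3 * #|I|)%N _ (exprn_gt0 _ (ltr0Sn _ _))).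
  move=> [C' [c [CC' C'0 c01 C'c]]].
  have [w [e [f [phi [w0 [[df sf _ wphi cphi] [E ce] _ [mix mv] _]]]]]] :=
    exists_near_optimal_pair hab hI c01.
  exists f, phi; split => //; rewrite E; have /andP[c0 _] := c01.
  apply: (mul_lt_of_bounds CC' C'0 mix mv).
  exact: lt_le_trans (numeric _ _ _ _ c0 w0 C'c) ce.
split.
  move=> C /(C'P _ (3 * d)%N _ (exprn_gt0 _ (ltr0Sn _ _))).
  move=> [C' [c [CC' C'0 c01 C'c]]].
  have T0 : finset.setTfor 'I_d != finset.set0.
    by apply/finset.set0Pn; exists (Ordinal hd); rewrite finset.in_setT.
  have [w [e [f [phi [w0 [[_ _ cf wphi cphi] [E ce] _ _ /(_ erefl)[l1 vit]]]]]]] :=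
    exists_near_optimal_pair hab T0 c01.
  exists f, phi; split => //; first by case: wphi.
  rewrite -[integral_box _ _ _]/(expectation_density a b f phi) E.
  have /andP[c0 _] := c01.
  apply: (mul_lt_of_bounds CC' C'0 l1 vit); apply: lt_le_trans ce.
  by rewrite finset.cardsT card_ord; exact: numeric.
(* Both bounds with the defect: f uniform and phi = 1. *)
pose f := tensor (fun i => ((b ord0 i - a ord0 i)^-1)%:P).
have L0 i : 0 < b ord0 i - a ord0 i by rewrite subr_gt0.
have df : prob_density a b f.
  apply: prob_density_tensor => [i t _|i]; first by rewrite hornerC invr_ge0 ltW.
  under eq_Rintegral do rewrite hornerC.
  by rewrite (Rintegral_itv_cst hab) mulVf// gt_eqF.
have Rphi : Linf_norm a b (calR a b I (cst 1)) = 1%E.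
  rewrite /calR calP_cst// /Linf_norm.
  under eq_fun do rewrite /= subr0 normr1.
  by rewrite ess_sup_cst//; exact: lebesgue_box_gt0.
have Ephi : expectation_density a b f (cst 1) = 1%E.
  have [_ _ <-] := df; congr (integral_box a b).
  by apply/funext => x; rewrite /= mul1r.
have Lphi : in_Linf a b (cst 1 : 'rV[R]_d -> R).
  by apply: in_Linf_continuous; exact: cst_continuous.
have [sl0 mix0] := envelopes_cst0 hab hI.
split=> C C1; exists f, (cst 1); split => //.
- apply: in_BV_tensor => // i x _; rewrite /tensor (bigD1 i)//=.
  by rewrite /tensor_deriv eqxx derivC horner0 mul0r.
- by rewrite calP_cst// sl0 mule0 mul0e add0e Rphi Ephi mule1 abse1 lte_fin.
- exact: Ck_closure_tensor.
- by rewrite calP_cst// mix0 mule0 mul0e add0e Rphi Ephi mule1 abse1 lte_fin.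
Qed.
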